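(* Let $(\mathcal{H},d)$ be an Hadamard space, let $k\in\mathbb{N}$, and let $f_1,\dots,f_k\colon\mathcal{H}\to(-\infty,\infty]$ be convex lower semicontinuous functions such that $f:=\sum_{j=1}^k f_j$ is not identically equal to $\infty$. Let $J_\lambda$ and $S_t$ denote the resolvent and gradient flow semigroup of $f$, let $J^j_\lambda$ and $S^j_t$ denote the resolvent and gradient flow semigroup of $f_j$, and let $P_j$ denote the metric projection onto $\overline{\operatorname{dom}}\, f_j$, for $j=1,\dots,k$. Then, for every $t\in[0,\infty)$ and $x\in\overline{\operatorname{dom}}\, f$, \[ S_t(x)=\lim_{n\to\infty}\left(J^k_{t/n}\circ\cdots\circ J^1_{t/n}\right)^{(n)}(x), \] and if moreover there exists $1\le l\le k$ such that $\operatorname{dom} f_l$ is locally compact, then for every $t\in[0,\infty)$ and $x\in\overline{\operatorname{dom}}\, f$, \[ S_t(x)=\lim_{n\to\infty}\left(S^k_{t/n}\circ P_k\circ\cdots\circ S^1_{t/n}\circ P_1\right)^{(n)}(x). \]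
   Context: An Hadamard space is a complete geodesic metric space $(\mathcal{H},d)$ satisfying, for every $x\in\mathcal{H}$, every geodesic $\gamma\colon[0,1]\to\mathcal{H}$ and every $t\in[0,1]$: $d(x,\gamma(t))^2\le(1-t)d(x,\gamma(0))^2+t\,d(x,\gamma(1))^2-t(1-t)d(\gamma(0),\gamma(1))^2$. A function $g\colon\mathcal{H}\to(-\infty,\infty]$ is convex if $g\circ\gamma$ is convex for every geodesic $\gamma\colon[0,1]\to\mathcal{H}$; $\operatorname{dom} g=\{x: g(x)<\infty\}$ and $\overline{\operatorname{dom}}\, g$ is its closure. For a convex lsc $g$ (not identically $\infty$) and $\lambda>0$, the resolvent is $J_\lambda(x):=\arg\min_{y\in\mathcal{H}}\big[g(y)+\frac{1}{2\lambda}d(x,y)^2\big]$ (a well-defined map $\mathcal{H}\to\overline{\operatorname{dom}}\, g$), with $J_0(x):=x$; the gradient flow semigroup is $S_t(x):=\lim_{n\to\infty}(J_{t/n})^{(n)}(x)$ for $x\in\overline{\operatorname{dom}}\, g$, $t\ge0$ (this limit exists). For a map $F\colon\mathcal{H}\to\mathcal{H}$, $F^{(n)}$ denotes the $n$-fold composition $F\circ\cdots\circ F$, with $F^{(0)}$ the identity. For a nonempty closed convex set $C\subset\mathcal{H}$, the metric projection $P_C(x)$ is the unique point of $C$ nearest to $x$. *)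

(* Defs.v *)
From Stdlib Require Import Reals Lra ClassicalEpsilon.
From Coquelicot Require Import Rbar.
Open Scope R_scope.

Section Hadamard.
Context {H : Type} (d : H -> H -> R).

Definition is_metric : Prop :=
  (forall x y, 0 <= d x y) /\
  (forall x y, d x y = 0 <-> x = y) /\
  (forall x y, d x y = d y x) /\
  (forall x y z, d x z <= d x y + d y z).

Definition seq_lim (u : nat -> H) (y : H) : Prop :=
  forall eps, 0 < eps -> exists N, forall n, (N <= n)%nat -> d (u n) y < eps.

Definition cauchy (u : nat -> H) : Prop :=
  forall eps, 0 < eps -> exists N, forall m n, (N <= m)%nat -> (N <= n)%nat ->
    d (u m) (u n) < eps.

Definition complete : Prop :=
  forall u, cauchy u -> exists y, seq_lim u y.

(** A (constant speed) geodesic [0,1] -> H, represented as a map R -> H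
    whose values outside [0,1] are irrelevant. *)
Definition geodesic (g : R -> H) : Prop :=
  forall s t, 0 <= s <= 1 -> 0 <= t <= 1 ->
    d (g s) (g t) = Rabs (s - t) * d (g 0) (g 1).

Definition geodesic_space : Prop :=
  forall x y, exists g, geodesic g /\ g 0 = x /\ g 1 = y.

Definition hadamard : Prop :=
  is_metric /\ complete /\ geodesic_space /\
  forall x g t, geodesic g -> 0 <= t <= 1 ->
    (d x (g t))^2 <= (1 - t) * (d x (g 0))^2 + t * (d x (g 1))^2
                     - t * (1 - t) * (d (g 0) (g 1))^2.

Definition never_minfty (f : H -> Rbar) : Prop := forall x, f x <> m_infty.

Definition dom (f : H -> Rbar) (x : H) : Prop := exists r, f x = Finite r.

Definition cl_dom (f : H -> Rbar) (x : H) : Prop :=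
  forall eps, 0 < eps -> exists y, dom f y /\ d x y < eps.

Definition convex (f : H -> Rbar) : Prop :=
  forall g, geodesic g ->
  forall s u lam a b, 0 <= s <= 1 -> 0 <= u <= 1 -> 0 <= lam <= 1 ->
    Rbar_le (f (g s)) (Finite a) -> Rbar_le (f (g u)) (Finite b) ->
    Rbar_le (f (g ((1 - lam) * s + lam * u))) (Finite ((1 - lam) * a + lam * b)).

Definition lsc (f : H -> Rbar) : Prop :=
  forall (u : nat -> H) x c, seq_lim u x ->
    (forall n, Rbar_le (f (u n)) (Finite c)) -> Rbar_le (f x) (Finite c).

Definition res_obj (f : H -> Rbar) (lam : R) (x y : H) : Rbar :=
  Rbar_plus (f y) (Finite ((d x y)^2 / (2 * lam))).

Definition is_res_min (f : H -> Rbar) (lam : R) (x y : H) : Prop :=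
  forall z, Rbar_le (res_obj f lam x y) (res_obj f lam x z).

Definition resolvent (f : H -> Rbar) (lam : R) (x : H) : H :=
  match Rle_dec lam 0 with
  | left _ => x
  | right _ => epsilon (inhabits x) (is_res_min f lam x)
  end.

Fixpoint iter (n : nat) (F : H -> H) (x : H) : H :=
  match n with O => x | S m => F (iter m F x) end.

Definition flow (f : H -> Rbar) (t : R) (x : H) : H :=
  epsilon (inhabits x)
    (seq_lim (fun n => iter n (resolvent f (t / INR n)) x)).

Definition proj (C : H -> Prop) (x : H) : H :=
  epsilon (inhabits x) (fun y => C y /\ forall z, C z -> d x y <= d x z).

(** Sum f_1 + ... + f_k where fs j = f_(j+1). *)
Fixpoint sumf (fs : nat -> H -> Rbar) (k : nat) (x : H) : Rbar :=
  match k with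
  | O => Finite 0
  | S j => Rbar_plus (sumf fs j x) (fs j x)
  end.

Fixpoint comp_res (fs : nat -> H -> Rbar) (k : nat) (lam : R) (x : H) : H :=
  match k with
  | O => x
  | S j => resolvent (fs j) lam (comp_res fs j lam x)
  end.

Fixpoint comp_flow_proj (fs : nat -> H -> Rbar) (k : nat) (t : R) (x : H) : H :=
  match k with
  | O => x
  | S j => flow (fs j) t (proj (cl_dom (fs j)) (comp_flow_proj fs j t x))
  end.

Definition seq_compact (K : H -> Prop) : Prop :=
  forall u : nat -> H, (forall n, K (u n)) ->
    exists (phi : nat -> nat) y,
      (forall n, (phi n < phi (S n))%nat) /\ K y /\ seq_lim (fun n => u (phi n)) y.

(** A set D is locally compact (in the induced metric): every point of D
    has a compact neighbourhood in D, i.e. some closed ball of D is compact. *)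
Definition locally_compact (D : H -> Prop) : Prop :=
  forall x, D x -> exists r, 0 < r /\ seq_compact (fun y => D y /\ d x y <= r).

End Hadamard.

(* Main.v *)
(* Let F_rho be the composition of the resolvents J^j_rho, respectively of the maps S^j_rho P_j. It
   is nonexpansive, hence has a resolvent R_{lam,rho} x: the fixed point y of
   y |-> (rho x + lam F_rho y)/(lam + rho), a point of the geodesic [x, F_rho y]. Kobayashi's
   estimate bounds d(R_{lam,rho}^m x0, F_rho^n x0) by L sqrt((m lam - n rho)^2 + m lam^2 + n rho^2)
   with rho L = d(x0, F_rho x0), and L stays bounded as rho -> 0 when x0 = R_{lam0,rho} x. So
   R_{lam,rho} x -> J_lam x (for all lam, x) implies that F_{t/n}^n x and J_{t/m}^m x have a common
   limit (Chernoff); the case F = J yields the existence of the flow.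
   For the convergence of resolvents, summing the variational inequalities of the k steps at y
   gives, for z in dom f and the intermediate points y_j,
     d(y,z)^2 + d(x,y)^2 + 2 lam sum_j f_j(y_j) + (lam/rho) sum_j e_j^2 <= d(x,z)^2 + 2 lam f(z),
   where e_j is the length of the j-th step, respectively of its projection part. With
   z = J_lam x it suffices to show liminf d(x,y)^2 + 2 lam sum_j f_j(y_j) >= d(x,z)^2 + 2 lam f(z).
   For resolvents all y_j approach y, and an argument with nested convex sets replaces weak
   compactness. For flows, bounded parts of sublevel sets of f_l are compact by Hopf-Rinow, which
   gives a limit of the y_l, and this limit propagates to all y_j. *)
Require Import Defs.
From Stdlib Require Import Reals Lra Lia Classical ClassicalEpsilon.
From Coquelicot Require Import Rbar Rcomplements.
Open Scope R_scope.

(** * Elementary facts about real numbers *)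

Section Real_facts.

Lemma pow2_le_inv (a b : R) : 0 <= b -> a ^ 2 <= b ^ 2 -> a <= b.
Proof. intros; nra. Qed.

Lemma pow2_lt_inv (a b : R) : 0 <= b -> a ^ 2 < b ^ 2 -> a < b.
Proof. intros; nra. Qed.

(** Packages the passage to the limit as [t] tends to 0, either to drop an error term or to let a
    geodesic parameter vanish. *)
Lemma arbitrarily_small_multiple (a b c : R) :
  0 <= c -> (forall t, 0 < t <= 1 -> a <= b + t * c) -> a <= b.
Proof.
  intros Hc Hab. apply Rnot_lt_le; intro Hlt.
  assert (Ht : 0 < (a - b) / (2 * (c + 1 + (a - b))) <= 1).
  { split.
    - apply Rdiv_lt_0_compat; lra.
    - apply Rle_div_l; lra. }
  specialize (Hab _ Ht).
  assert (Hx : (a - b) / (2 * (c + 1 + (a - b))) * c <= (a - b) / 2).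
  { replace ((a - b) / (2 * (c + 1 + (a - b))) * c)
      with ((a - b) / 2 * (c / (c + 1 + (a - b)))) by (field; lra).
    assert (c / (c + 1 + (a - b)) <= 1) by (apply Rle_div_l; lra).
    nra. }
  lra.
Qed.

Lemma archimed_inv (eps : R) : 0 < eps -> exists N, forall n, (N <= n)%nat -> / (INR n + 1) < eps.
Proof.
  intros He. destruct (INR_unbounded (/ eps)) as [N HN].
  exists N; intros n Hn. apply le_INR in Hn.
  rewrite <- (Rinv_inv eps). apply Rinv_lt_contravar.
  - apply Rmult_lt_0_compat; [apply Rinv_0_lt_compat; lra|].
    pose proof (pos_INR n); lra.
  - lra.
Qed.

Lemma inv_INR_pos (n : nat) : 0 < / (INR n + 1).
Proof. apply Rinv_0_lt_compat. pose proof (pos_INR n); lra. Qed.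

Lemma inv_INR_anti (m n : nat) : (m <= n)%nat -> / (INR n + 1) <= / (INR m + 1).
Proof.
  intros Hmn. apply le_INR in Hmn. apply Rinv_le_contravar; pose proof (pos_INR m); lra.
Qed.

Lemma infimum (P : R -> Prop) (m0 : R) :
  (exists a, P a) -> (forall a, P a -> m0 <= a) ->
  exists m, (forall a, P a -> m <= a) /\ (forall eps, 0 < eps -> exists a, P a /\ a < m + eps) /\ m0 <= m.
Proof.
  intros [a0 Ha0] Hm0.
  destruct (completeness (fun b => P (- b))) as [s [Hs1 Hs2]].
  - exists (- m0). intros b Hb. specialize (Hm0 _ Hb). lra.
  - exists (- a0). now rewrite Ropp_involutive.
  - exists (- s). split; [|split].
    + intros a Ha. assert (- a <= s) by (apply Hs1; now rewrite Ropp_involutive). lra.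
    + intros eps He. apply NNPP; intro Hn.
      assert (s <= s - eps); [|lra].
      apply Hs2. intros b Hb. apply Rnot_lt_le; intro Hlt.
      apply Hn. exists (- b); split; [exact Hb | lra].
    + assert (s <= - m0); [|lra]. apply Hs2. intros b Hb. specialize (Hm0 _ Hb). lra.
Qed.

Lemma monotone_bounded_cauchy (r : nat -> R) (M : R) :
  (forall m n, (m <= n)%nat -> r m <= r n) -> (forall n, r n <= M) ->
  forall eps, 0 < eps -> exists N, forall m n, (N <= m)%nat -> (N <= n)%nat -> r m - r n < eps.
Proof.
  intros Hmon HM eps He.
  destruct (completeness (fun b => exists n, b = r n)) as [s [Hs1 Hs2]].
  - exists M. intros b [n ->]. apply HM.
  - exists (r 0%nat); now exists 0%nat.
  - assert (Hex : exists N, s - eps < r N).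
    { apply NNPP; intro Hn. assert (s <= s - eps); [|lra].
      apply Hs2. intros b [n ->]. apply Rnot_lt_le; intro Hlt. apply Hn; now exists n. }
    destruct Hex as [N HN]. exists N. intros m n Hm Hn.
    assert (r m <= s) by (apply Hs1; now exists m).
    pose proof (Hmon _ _ Hn). lra.
Qed.

End Real_facts.

(** * Hadamard spaces *)

Section Hadamard_space.
Context {H : Type} {d : H -> H -> R} (Hd : hadamard d).

Lemma dist_ge0 x y : 0 <= d x y.
Proof. apply Hd. Qed.

Lemma dist_xx x : d x x = 0.
Proof. now apply Hd. Qed.

Lemma dist_eq0 x y : d x y = 0 -> x = y.
Proof. apply Hd. Qed.

Lemma dist_sym x y : d x y = d y x.
Proof. apply Hd. Qed.

Lemma dist_tri x y z : d x z <= d x y + d y z.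
Proof. apply Hd. Qed.

Lemma dist_le0_eq x y : (forall eps, 0 < eps -> d x y <= eps) -> x = y.
Proof.
  intros He. apply dist_eq0. apply Rle_antisym; [|apply dist_ge0].
  apply Rnot_lt_le; intro Hlt. specialize (He (d x y / 2)). lra.
Qed.

(** One geodesic is selected for each pair of points, so that convexity and the CN inequality become
    statements about a function of [x], [y] and [t]. *)
Definition geo (x y : H) : R -> H :=
  proj1_sig (constructive_indefinite_description _ (proj1 (proj2 (proj2 Hd)) x y)).

Lemma geo_spec x y : geodesic d (geo x y) /\ geo x y 0 = x /\ geo x y 1 = y.
Proof. unfold geo. now destruct constructive_indefinite_description. Qed.

Lemma dist_geo_l x y t : 0 <= t <= 1 -> d x (geo x y t) = t * d x y.
Proof.
  intros Ht. destruct (geo_spec x y) as [Hg [H0 H1]].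
  pose proof (Hg 0 t) as E. rewrite H0, H1 in E. rewrite E by lra.
  rewrite Rabs_left1 by lra. lra.
Qed.

Lemma dist_geo_r x y t : 0 <= t <= 1 -> d (geo x y t) y = (1 - t) * d x y.
Proof.
  intros Ht. destruct (geo_spec x y) as [Hg [H0 H1]].
  pose proof (Hg t 1) as E. rewrite H0, H1 in E. rewrite E by lra.
  rewrite Rabs_left1 by lra. lra.
Qed.

Lemma cn_geo x y z t : 0 <= t <= 1 ->
  d z (geo x y t) ^ 2 <= (1 - t) * d z x ^ 2 + t * d z y ^ 2 - t * (1 - t) * d x y ^ 2.
Proof.
  intros Ht. destruct (geo_spec x y) as [Hg [H0 H1]].
  pose proof (proj2 (proj2 (proj2 Hd)) z _ t Hg Ht) as E. now rewrite H0, H1 in E.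
Qed.

(** Since [d x y] is at least the difference of [d z x] and [d z y], the right side of the CN
    inequality is at most the square of the convex combination. *)
Lemma dist_geo_convex x y z t : 0 <= t <= 1 ->
  d z (geo x y t) <= (1 - t) * d z x + t * d z y.
Proof.
  intros Ht. pose proof (dist_ge0 z x). pose proof (dist_ge0 z y).
  apply pow2_le_inv; [nra|].
  eapply Rle_trans; [apply cn_geo, Ht|].
  assert (Hxy : (d z x - d z y) ^ 2 <= d x y ^ 2).
  { pose proof (dist_tri z x y). pose proof (dist_tri z y x).
    pose proof (dist_ge0 x y). rewrite (dist_sym y x) in *. nra. }
  assert (0 <= t * (1 - t)) by nra.
  nra.
Qed.

(* Compare the fourth vertex pair through the point at parameter [t] of the
   diagonal [x u]; a weighted Young inequality leaves the weight [t/(1-t)],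
   which is then optimised. *)
Lemma quadrilateral x y u v :
  d x u ^ 2 + d y v ^ 2 <= d x y ^ 2 + d u v ^ 2 + 2 * d x v * d y u.
Proof.
  assert (Hw : forall w, 0 < w ->
    d x u ^ 2 + d y v ^ 2 <= d x y ^ 2 + d u v ^ 2 + (w * d y u ^ 2 + / w * d x v ^ 2)).
  { intros w Hw0. set (t := w / (1 + w)).
    assert (Ht : 0 < t < 1).
    { unfold t. split; [apply Rdiv_lt_0_compat; lra | apply Rlt_div_l; lra]. }
    pose proof (cn_geo x u y t ltac:(lra)) as Hy.
    pose proof (cn_geo x u v t ltac:(lra)) as Hv.
    set (p := geo x u t) in *.
    pose proof (dist_tri y p v) as Htri. rewrite (dist_sym p v) in Htri.
    pose proof (dist_ge0 y v). pose proof (dist_ge0 y p). pose proof (dist_ge0 v p).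
    assert (Hyoung : (d y p + d v p) ^ 2 <= d y p ^ 2 / (1 - t) + d v p ^ 2 / t).
    { assert (E : d y p ^ 2 / (1 - t) + d v p ^ 2 / t - (d y p + d v p) ^ 2
                  = (t * d y p - (1 - t) * d v p) ^ 2 / (t * (1 - t))) by (field; lra).
      assert (0 <= (t * d y p - (1 - t) * d v p) ^ 2 / (t * (1 - t))); [|lra].
      apply Rdiv_le_0_compat; [apply pow2_ge_0 | nra]. }
    assert (d y v ^ 2 <= (d y p + d v p) ^ 2) by nra.
    assert (d y p ^ 2 / (1 - t) <= d y x ^ 2 + t / (1 - t) * d y u ^ 2 - t * d x u ^ 2).
    { apply Rle_div_l; [lra|]. eapply Rle_trans; [apply Hy|]. apply Req_le. field; lra. }
    assert (d v p ^ 2 / t <= (1 - t) / t * d v x ^ 2 + d v u ^ 2 - (1 - t) * d x u ^ 2).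
    { apply Rle_div_l; [lra|]. eapply Rle_trans; [apply Hv|]. apply Req_le. field; lra. }
    assert (E1 : t / (1 - t) = w) by (unfold t; field; lra).
    assert (E2 : (1 - t) / t = / w) by (unfold t; field; lra).
    rewrite E1, E2 in *. rewrite (dist_sym y x), (dist_sym v x), (dist_sym v u) in *. lra. }
  pose proof (dist_ge0 y u) as Ha. pose proof (dist_ge0 x v) as Hb.
  (* The optimal weight is [d x v / d y u]; adding [e] to both distances keeps it defined and
     positive when one of them vanishes. *)
  apply (arbitrarily_small_multiple _ _ (d y u + d x v + 2 * d y u + 2 * d x v + 2)); [lra|].
  intros e He.
  specialize (Hw ((d x v + e) / (d y u + e)) ltac:(apply Rdiv_lt_0_compat; lra)).
  assert ((d x v + e) / (d y u + e) * d y u ^ 2 <= (d x v + e) * d y u).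
  { replace ((d x v + e) / (d y u + e) * d y u ^ 2)
      with ((d x v + e) * d y u * (d y u / (d y u + e))) by (field; lra).
    assert (d y u / (d y u + e) <= 1) by (apply Rle_div_l; lra).
    assert (0 <= (d x v + e) * d y u) by nra. nra. }
  assert (/ ((d x v + e) / (d y u + e)) * d x v ^ 2 <= (d y u + e) * d x v).
  { replace (/ ((d x v + e) / (d y u + e)) * d x v ^ 2)
      with ((d y u + e) * d x v * (d x v / (d x v + e))) by (field; lra).
    assert (d x v / (d x v + e) <= 1) by (apply Rle_div_l; lra).
    assert (0 <= (d y u + e) * d x v) by nra. nra. }
  nra.
Qed.

(** Two uses of the CN inequality, first from [geo x p s] to the geodesic towards [q], then from [q]
    to the geodesic towards [p]. All terms in [d x p] and [d x q] cancel, leaving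
    [s ^ 2 * d p q ^ 2]. *)
Lemma dist_geo_same_origin x p q s : 0 <= s <= 1 ->
  d (geo x p s) (geo x q s) <= s * d p q.
Proof.
  intros Hs. pose proof (dist_ge0 p q).
  apply pow2_le_inv; [nra|].
  pose proof (cn_geo x q (geo x p s) s Hs) as A.
  pose proof (cn_geo x p q s Hs) as B.
  rewrite (dist_sym (geo x p s) x), dist_geo_l in A by lra.
  rewrite (dist_sym (geo x p s) q) in A.
  rewrite (dist_sym q x), (dist_sym q p) in B.
  nra.
Qed.

Lemma dist_geo_same_end x u v s : 0 <= s <= 1 ->
  d (geo x v s) (geo u v s) <= (1 - s) * d x u.
Proof.
  intros Hs. pose proof (dist_ge0 x u).
  apply pow2_le_inv; [nra|].
  pose proof (cn_geo u v (geo x v s) s Hs) as A.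
  pose proof (cn_geo x v u s Hs) as B.
  rewrite dist_geo_r in A by lra.
  rewrite (dist_sym (geo x v s) u) in A.
  rewrite (dist_sym u x) in B.
  nra.
Qed.

(** The diagonal geodesic from [x] to [v] shares its origin with one side and its end with the
    other. *)
Lemma dist_geo_geo x y u v t : 0 <= t <= 1 ->
  d (geo x y t) (geo u v t) <= (1 - t) * d x u + t * d y v.
Proof.
  intros Ht. pose proof (dist_tri (geo x y t) (geo x v t) (geo u v t)).
  pose proof (dist_geo_same_origin x y v t Ht).
  pose proof (dist_geo_same_end x u v t Ht). lra.
Qed.

(** * Limits of sequences, nested convex sets and fixed points *)

Lemma seq_lim_unique u y z : seq_lim d u y -> seq_lim d u z -> y = z.
Proof.
  intros Hy Hz. apply dist_le0_eq. intros eps He.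
  destruct (Hy (eps / 2) ltac:(lra)) as [N HN]. destruct (Hz (eps / 2) ltac:(lra)) as [M HM].
  specialize (HN (N + M)%nat ltac:(lia)). specialize (HM (N + M)%nat ltac:(lia)).
  pose proof (dist_tri y (u (N + M)%nat) z). pose proof (dist_sym y (u (N + M)%nat)). lra.
Qed.

Lemma seq_lim_near (u v : nat -> H) y :
  (forall eps, 0 < eps -> exists N, forall n, (N <= n)%nat -> d (u n) (v n) < eps) ->
  seq_lim d u y -> seq_lim d v y.
Proof.
  intros Huv Hu eps He.
  destruct (Huv (eps / 2) ltac:(lra)) as [N HN]. destruct (Hu (eps / 2) ltac:(lra)) as [M HM].
  exists (N + M)%nat. intros n Hn. specialize (HN n ltac:(lia)). specialize (HM n ltac:(lia)).
  pose proof (dist_tri (v n) (u n) y). pose proof (dist_sym (v n) (u n)). lra.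
Qed.

Lemma increasing_ge (phi : nat -> nat) :
  (forall n, (phi n < phi (S n))%nat) -> forall n, (n <= phi n)%nat.
Proof. intros Hp n. induction n; [lia|]. specialize (Hp n). lia. Qed.

Lemma increasing_lt (phi : nat -> nat) :
  (forall n, (phi n < phi (S n))%nat) -> forall m n, (m < n)%nat -> (phi m < phi n)%nat.
Proof.
  intros Hp m n Hmn. induction Hmn as [|n Hmn IH]; [apply Hp|]. specialize (Hp n). lia.
Qed.

Lemma seq_lim_subseq (u : nat -> H) y (phi : nat -> nat) :
  (forall n, (n <= phi n)%nat) -> seq_lim d u y -> seq_lim d (fun n => u (phi n)) y.
Proof.
  intros Hp Hu eps He. destruct (Hu eps He) as [N HN].
  exists N. intros n Hn. apply HN. specialize (Hp n). lia.
Qed.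

Lemma dist_seq_lim (u : nat -> H) y z eps : seq_lim d u y -> 0 < eps ->
  exists N, forall n, (N <= n)%nat -> Rabs (d z (u n) - d z y) < eps.
Proof.
  intros Hu He. destruct (Hu eps He) as [N HN]. exists N. intros n Hn. specialize (HN n Hn).
  pose proof (dist_tri z (u n) y). pose proof (dist_tri z y (u n)).
  pose proof (dist_sym y (u n)). apply Rabs_def1; lra.
Qed.

Lemma dist_sqr_seq_lim (u : nat -> H) y z eps : seq_lim d u y -> 0 < eps ->
  exists N, forall n, (N <= n)%nat -> Rabs (d z (u n) ^ 2 - d z y ^ 2) < eps.
Proof.
  intros Hu He. pose proof (dist_ge0 z y).
  (* A difference of squares is the difference times the sum, and the sum is at most [2 * d z y + 1]
     once the difference is below 1. *)
  set (e := Rmin 1 (eps / (2 * d z y + 2))).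
  assert (He' : 0 < e) by (apply Rmin_pos; [lra | apply Rdiv_lt_0_compat; lra]).
  assert (He1 : e <= 1) by apply Rmin_l.
  assert (He2 : e * (2 * d z y + 2) <= eps).
  { apply Rle_div_r; [lra|]. apply Rmin_r. }
  destruct (dist_seq_lim u y z e Hu He') as [N HN]. exists N. intros n Hn.
  specialize (HN n Hn). apply Rabs_def2 in HN. pose proof (dist_ge0 z (u n)).
  apply Rabs_def1; nra.
Qed.

Lemma dist_seq_lim_le (u : nat -> H) y z c :
  seq_lim d u y -> (forall n, d z (u n) <= c) -> d z y <= c.
Proof.
  intros Hu Hc. apply (arbitrarily_small_multiple _ _ 1); [lra|]. intros t Ht.
  destruct (dist_seq_lim u y z t Hu ltac:(lra)) as [N HN].
  specialize (HN N ltac:(lia)). apply Rabs_def2 in HN. specialize (Hc N). lra.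
Qed.

Lemma dist_seq_lim2_le (u v : nat -> H) y z c :
  seq_lim d u y -> seq_lim d v z -> (forall n, d (u n) (v n) <= c) -> d y z <= c.
Proof.
  intros Hu Hv Hc. apply (arbitrarily_small_multiple _ _ 2); [lra|]. intros t Ht.
  destruct (Hu t ltac:(lra)) as [N HN]. destruct (Hv t ltac:(lra)) as [M HM].
  specialize (HN (N + M)%nat ltac:(lia)). specialize (HM (N + M)%nat ltac:(lia)).
  specialize (Hc (N + M)%nat).
  pose proof (dist_tri y (u (N + M)%nat) z). pose proof (dist_tri (u (N + M)%nat) (v (N + M)%nat) z).
  pose proof (dist_sym y (u (N + M)%nat)). lra.
Qed.

(* Stands in for weak compactness: points of [C n] almost nearest to [x] form
   a Cauchy sequence, by the CN inequality at midpoints. *)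
Lemma nested_convex_sets (C : nat -> H -> Prop) (x : H) (B : R) :
  (forall m n y, (m <= n)%nat -> C n y -> C m y) ->
  (forall n y z, C n y -> C n z -> C n (geo y z (1 / 2))) ->
  (forall n, exists y, C n y /\ d x y <= B) ->
  exists (u : nat -> H) (y : H), (forall n, C n (u n)) /\ seq_lim d u y.
Proof.
  intros Hdec Hmid Hne.
  assert (Hr : forall n, exists r, (forall y, C n y -> r <= d x y ^ 2) /\
    (forall eps, 0 < eps -> exists y, C n y /\ d x y ^ 2 < r + eps)).
  { intros n. destruct (infimum (fun a => exists y, C n y /\ a = d x y ^ 2) 0) as [r [Hr1 [Hr2 _]]].
    - destruct (Hne n) as [y [Hy _]]. now exists (d x y ^ 2), y.
    - intros a [y [_ ->]]. apply pow2_ge_0.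
    - exists r. split.
      + intros y Hy. apply Hr1. now exists y.
      + intros eps He. destruct (Hr2 eps He) as [a [[y [Hy ->]] Ha]]. now exists y. }
  destruct (choice _ Hr) as [r Hr']. clear Hr.
  assert (Hu : forall n, exists y, C n y /\ d x y ^ 2 < r n + / (INR n + 1)).
  { intros n. apply (proj2 (Hr' n)), inv_INR_pos. }
  destruct (choice _ Hu) as [u Hu']. clear Hu.
  assert (Hmon : forall m n, (m <= n)%nat -> r m <= r n).
  { intros m n Hmn. apply Rnot_lt_le; intro Hlt.
    destruct (proj2 (Hr' n) (r m - r n) ltac:(lra)) as [y [Hy Hy']].
    pose proof (proj1 (Hr' m) y (Hdec _ _ _ Hmn Hy)). lra. }
  assert (HB : forall n, r n <= B ^ 2).
  { intros n. destruct (Hne n) as [y [Hy HyB]]. pose proof (proj1 (Hr' n) y Hy).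
    pose proof (dist_ge0 x y). nra. }
  assert (Hc : cauchy d u).
  { intros eps He.
    destruct (monotone_bounded_cauchy r _ Hmon HB (eps ^ 2 / 8)) as [N1 HN1]; [nra|].
    destruct (archimed_inv (eps ^ 2 / 16)) as [N2 HN2]; [nra|].
    assert (Hle : forall m n, (N1 + N2 <= m)%nat -> (m <= n)%nat -> d (u m) (u n) < eps).
    (* The midpoint of [u m] and [u n] still lies in [C m], so its squared distance to [x] is at
       least [r m]. The CN inequality then bounds a quarter of [d (u m) (u n) ^ 2] by the mean
       excess over [r m]. *)
    { intros m n Hm Hmn. apply pow2_lt_inv; [lra|].
      destruct (Hu' m) as [Cm Dm]. destruct (Hu' n) as [Cn Dn].
      pose proof (proj1 (Hr' m) _ (Hmid m _ _ Cm (Hdec _ _ _ Hmn Cn))) as Hlow.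
      pose proof (cn_geo (u m) (u n) x (1 / 2) ltac:(lra)) as Hcn.
      specialize (HN1 n m ltac:(lia) ltac:(lia)).
      pose proof (HN2 m ltac:(lia)). pose proof (HN2 n ltac:(lia)). nra. }
    exists (N1 + N2)%nat. intros m n Hm Hn.
    destruct (Nat.le_ge_cases m n); [now apply Hle|]. rewrite dist_sym. now apply Hle. }
  destruct (proj1 (proj2 Hd) u Hc) as [y Hy].
  exists u, y. split; [intros n; apply Hu' | exact Hy].
Qed.

Lemma contraction_fixpoint (T : H -> H) (b : R) (x : H) : 0 <= b < 1 ->
  (forall y z, d (T y) (T z) <= b * d y z) -> exists y, T y = y.
Proof.
  intros Hb HT.
  assert (Hx : forall n, (1 - b) * d x (iter n T x) <= d x (T x)).
  { induction n as [|n IH]; simpl.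
    - rewrite dist_xx. pose proof (dist_ge0 x (T x)). lra.
    - pose proof (dist_tri x (T x) (T (iter n T x))). pose proof (HT x (iter n T x)).
      nra. }
  assert (Hit : forall m n, (1 - b) * d (iter m T x) (iter (m + n) T x) <= b ^ m * d x (T x)).
  { induction m as [|m IH]; intros n; simpl.
    - rewrite Rmult_1_l. apply Hx.
    - pose proof (HT (iter m T x) (iter (m + n) T x)). specialize (IH n). nra. }
  assert (Hc : cauchy d (fun n => iter n T x)).
  { intros eps He. pose proof (dist_ge0 x (T x)) as H0.
    destruct (pow_lt_1_zero b ltac:(rewrite Rabs_right; lra) (eps * (1 - b) / (d x (T x) + 1)))
      as [N HN]; [apply Rdiv_lt_0_compat; nra|].
    assert (Hle : forall m n, (N <= m)%nat -> (m <= n)%nat -> d (iter m T x) (iter n T x) < eps).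
    { intros m n Hm Hmn. replace n with (m + (n - m))%nat by lia.
      specialize (Hit m (n - m)%nat). specialize (HN m Hm). apply Rabs_def2 in HN.
      destruct HN as [HN _]. apply Rlt_div_r in HN; [|lra].
      pose proof (pow_le b m ltac:(lra)).
      set (D := d (iter m T x) _) in *. nra. }
    exists N. intros m n Hm Hn.
    destruct (Nat.le_ge_cases m n); [now apply Hle|]. rewrite dist_sym. now apply Hle. }
  destruct (proj1 (proj2 Hd) _ Hc) as [y Hy]. exists y.
  apply (seq_lim_unique (fun n => iter (S n) T x)).
  - intros eps He. destruct (Hy eps He) as [N HN]. exists N. intros n Hn. simpl.
    specialize (HN n Hn). pose proof (HT (iter n T x) y). pose proof (dist_ge0 (iter n T x) y). nra.
  - apply (seq_lim_subseq (fun n => iter n T x) y S); [lia | exact Hy].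
Qed.

(** * Convex lower semicontinuous functions and their resolvents *)

(* Convex lsc function with effective domain [D]; the values of [phi] outside [D] are
   irrelevant. *)
Record clf (D : H -> Prop) (phi : H -> R) : Prop := {
  clf_convex : forall x y t, D x -> D y -> 0 <= t <= 1 ->
    D (geo x y t) /\ phi (geo x y t) <= (1 - t) * phi x + t * phi y;
  clf_closed : forall u y c, seq_lim d u y ->
    (forall n, D (u n) /\ phi (u n) <= c) -> D y /\ phi y <= c }.

Lemma clf_closed_eventually D phi u y c : clf D phi -> seq_lim d u y ->
  (forall eps, 0 < eps -> exists N, forall n, (N <= n)%nat -> D (u n) /\ phi (u n) <= c + eps) ->
  D y /\ phi y <= c.
Proof.
  intros Hf Hu He.
  assert (Heps : forall eps, 0 < eps -> D y /\ phi y <= c + eps).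
  { intros eps He0. destruct (He eps He0) as [N HN].
    apply (clf_closed _ _ Hf (fun n => u (N + n)%nat)).
    - apply (seq_lim_subseq u y (fun n => (N + n)%nat)); [lia | exact Hu].
    - intros n. apply HN. lia. }
  split; [apply (Heps 1); lra|].
  apply (arbitrarily_small_multiple _ _ 1); [lra|]. intros t Ht.
  destruct (Heps t); lra.
Qed.

(** Otherwise the parts of the sublevel sets at height [- INR n] inside the ball are nonempty,
    nested and convex. Lower semicontinuity would give the resulting limit point a value below every
    [- INR n]. *)
Lemma clf_bounded_below D phi x B : clf D phi ->
  exists m, forall y, D y -> d x y <= B -> m <= phi y.
Proof.
  intros Hf. apply NNPP; intro Hn.
  destruct (nested_convex_sets (fun n y => D y /\ d x y <= B /\ phi y <= - INR n) x B)
    as [u [y [Hu Hy]]].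
  - intros m n y Hmn [H1 [H2 H3]]. apply le_INR in Hmn. repeat split; try tauto; lra.
  - intros n y z [Hy1 [Hy2 Hy3]] [Hz1 [Hz2 Hz3]].
    destruct (clf_convex _ _ Hf y z (1 / 2) Hy1 Hz1 ltac:(lra)).
    pose proof (dist_geo_convex y z x (1 / 2) ltac:(lra)).
    repeat split; try assumption; lra.
  - intros n. apply NNPP; intro Hn'. apply Hn. exists (- INR n). intros y Hy HB.
    apply Rnot_lt_le; intro Hlt. apply Hn'. exists y. repeat split; try assumption. lra.
  - assert (Hall : forall n, D y /\ phi y <= - INR n).
    { intros n. apply (clf_closed_eventually D phi u); [exact Hf | exact Hy |].
      intros eps He. exists n. intros p Hp. destruct (Hu p) as [H1 [_ H2]].
      apply le_INR in Hp. split; [exact H1 | lra]. }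
    destruct (INR_unbounded (- phi y)) as [n Hn']. destruct (Hall n). lra.
Qed.

(** Fix [z] in [D]. For [y] farther than 1 from [z], convexity on the geodesic from [z] to [y] is
    used at its point at distance 1 from [z], where [clf_bounded_below] applies. *)
Lemma clf_linear_below D phi x : clf D phi ->
  exists b, 0 <= b /\ forall y, D y -> - b * (1 + d x y) <= phi y.
Proof.
  intros Hf. destruct (classic (exists z, D z)) as [[z Hz]|Hne].
  2: { exists 0. split; [lra|]. intros y Hy. exfalso. eauto. }
  destruct (clf_bounded_below D phi z 1 Hf) as [m Hm].
  set (b := Rabs m + Rabs (phi z)).
  pose proof (Rabs_pos m). pose proof (Rabs_pos (phi z)).
  pose proof (Rle_abs (- m)) as Hm1. rewrite Rabs_Ropp in Hm1.
  pose proof (Rle_abs (phi z)) as Hz1.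
  assert (Hb : forall y, D y -> - b * (1 + d z y) <= phi y).
  { intros y Hy. pose proof (dist_ge0 z y).
    assert (0 <= b * d z y) by (apply Rmult_le_pos; unfold b; lra).
    destruct (Rle_dec (d z y) 1) as [Hle|Hgt].
    - specialize (Hm y Hy Hle). unfold b in *. lra.
    - apply Rnot_le_lt in Hgt.
      assert (Ht : 0 <= / d z y <= 1).
      { split; [left; apply Rinv_0_lt_compat; lra|].
        rewrite <- Rinv_1. apply Rinv_le_contravar; lra. }
      destruct (clf_convex _ _ Hf z y _ Hz Hy Ht) as [Dp Hp].
      specialize (Hm _ Dp). rewrite dist_geo_l, Rinv_l in Hm by lra. specialize (Hm ltac:(lra)).
      set (p := geo z y (/ d z y)) in *.
      assert (Hp' : d z y * phi p <= (d z y - 1) * phi z + phi y).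
      { replace ((d z y - 1) * phi z + phi y)
          with (d z y * ((1 - / d z y) * phi z + / d z y * phi y)) by (field; lra).
        apply Rmult_le_compat_l; lra. }
      assert (- Rabs m * d z y <= d z y * phi p) by nra.
      assert ((d z y - 1) * phi z <= d z y * Rabs (phi z)) by nra.
      unfold b in *. lra. }
  (* Moving the centre from [z] to [x] costs this factor, since
     [1 + d z y <= (1 + d z x) * (1 + d x y)]. *)
  exists (b * (1 + d z x)). pose proof (dist_ge0 z x).
  assert (0 <= b) by (unfold b; lra).
  split; [nra|]. intros y Hy. specialize (Hb y Hy).
  pose proof (dist_tri z x y). pose proof (dist_ge0 x y).
  assert (b * (1 + d z y) <= b * ((1 + d z x) * (1 + d x y))) by
    (apply Rmult_le_compat_l; nra).
  lra.
Qed.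

(** Almost minimal sublevel sets are nested and convex, and coercivity keeps them within bounded
    distance of [x]. Hence [nested_convex_sets] supplies a convergent minimising sequence. *)
Lemma clf_argmin D h x m0 : clf D h -> (exists y, D y) -> (forall y, D y -> m0 <= h y) ->
  (forall c, exists B, forall y, D y -> h y <= c -> d x y <= B) ->
  exists y, D y /\ forall z, D z -> h y <= h z.
Proof.
  intros Hf [y0 Hy0] Hm0 Hco.
  destruct (infimum (fun a => exists y, D y /\ a = h y) m0) as [m [Hm1 [Hm2 _]]].
  { now exists (h y0), y0. }
  { intros a [y [Hy ->]]. now apply Hm0. }
  destruct (Hco (m + 1)) as [B HB].
  destruct (nested_convex_sets (fun n y => D y /\ h y <= m + / (INR n + 1)) x B) as [u [y [Hu Hy]]].
  - intros p n y Hpn [H1 H2]. pose proof (inv_INR_anti _ _ Hpn). split; [tauto | lra].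
  - intros n y z [Hy1 Hy2] [Hz1 Hz2].
    destruct (clf_convex _ _ Hf y z (1 / 2) Hy1 Hz1 ltac:(lra)). split; [assumption | lra].
  - intros n. destruct (Hm2 _ (inv_INR_pos n)) as [a [[y [Hy ->]] Ha]].
    exists y. repeat split; [exact Hy | lra |]. apply HB; [exact Hy|].
    pose proof (inv_INR_anti 0 n ltac:(lia)) as Hn. simpl in Hn. rewrite Rplus_0_l, Rinv_1 in Hn. lra.
  - destruct (clf_closed_eventually D h u y m Hf Hy) as [Hy1 Hy2].
    + intros eps He. destruct (archimed_inv eps He) as [N HN]. exists N. intros n Hn.
      specialize (HN n Hn). destruct (Hu n). split; [assumption | lra].
    + exists y. split; [exact Hy1|]. intros z Hz. apply Rle_trans with m; [exact Hy2|].
      apply Hm1. now exists z.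
Qed.

Lemma clf_add_sqdist D phi x w : clf D phi -> 0 <= w ->
  clf D (fun y => phi y + w * d x y ^ 2).
Proof.
  intros Hf Hw. split.
  - intros y z t Hy Hz Ht. destruct (clf_convex _ _ Hf y z t Hy Hz Ht). split; [assumption|].
    pose proof (cn_geo y z x t Ht). assert (0 <= t * (1 - t) * d y z ^ 2) by
      (apply Rmult_le_pos; [nra | apply pow2_ge_0]). nra.
  - intros u y c Hu Hc.
    destruct (clf_closed_eventually D phi u y (c - w * d x y ^ 2) Hf Hu) as [Hy1 Hy2].
    + intros eps He.
      destruct (dist_sqr_seq_lim u y x (eps / (w + 1)) Hu) as [N HN];
        [apply Rdiv_lt_0_compat; lra|].
      exists N. intros n Hn. specialize (HN n Hn). apply Rabs_def2 in HN.
      destruct (Hc n) as [H1 H2]. split; [exact H1|].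
      assert (w * (eps / (w + 1)) <= eps).
      { replace (w * (eps / (w + 1))) with (eps * (w / (w + 1))) by (field; lra).
        assert (w / (w + 1) <= 1) by (apply Rle_div_l; lra). nra. }
      nra.
    + split; [exact Hy1 | lra].
Qed.

(** * Existence of resolvents and their basic inequalities *)

Definition prox (D : H -> Prop) (phi : H -> R) (lam : R) (x y : H) : Prop :=
  D y /\ forall z, D z -> phi y + d x y ^ 2 / (2 * lam) <= phi z + d x z ^ 2 / (2 * lam).

Lemma prox_exists D phi lam x : clf D phi -> (exists y, D y) -> 0 < lam ->
  exists y, prox D phi lam x y.
Proof.
  intros Hf Hne Hl. destruct (clf_linear_below D phi x Hf) as [b [Hb Hlow]].
  set (w := / (2 * lam)).
  assert (Hw : 0 < w) by (apply Rinv_0_lt_compat; lra).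
  (* The lower bound comes from completing the square in [w * d x y ^ 2 - b * d x y]. *)
  destruct (clf_argmin D (fun y => phi y + w * d x y ^ 2) x (- b - b ^ 2 / (2 * w))) as [y [Hy1 Hy2]].
  - apply clf_add_sqdist; [exact Hf | lra].
  - exact Hne.
  - intros y Hy. specialize (Hlow y Hy).
    assert (E : w * d x y ^ 2 - b * d x y + b ^ 2 / (2 * w)
              = w / 2 * d x y ^ 2 + w / 2 * (d x y - b / w) ^ 2) by (field; lra).
    assert (0 <= w / 2 * d x y ^ 2 + w / 2 * (d x y - b / w) ^ 2).
    { apply Rplus_le_le_0_compat; apply Rmult_le_pos; try apply pow2_ge_0; lra. }
    lra.
  (* Beyond distance [1 + K] the quadratic term exceeds [Rabs c + b + b * d x y], which makes the
     objective larger than [c]. *)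
  - intros c. set (K := (Rabs c + b + b) / w).
    exists (1 + K). intros y Hy Hc. specialize (Hlow y Hy).
    pose proof (dist_ge0 x y). pose proof (Rle_abs c). pose proof (Rabs_pos c).
    assert (HK : w * K = Rabs c + b + b) by (unfold K; field; lra).
    apply Rnot_lt_le; intro Hlt.
    assert (0 <= K) by (apply Rdiv_le_0_compat; lra).
    assert (0 <= w * d x y * (d x y - (1 + K))) by (repeat apply Rmult_le_pos; lra).
    replace (w * d x y * (d x y - (1 + K)))
      with (w * d x y ^ 2 - w * d x y - (w * K) * d x y) in * by ring.
    rewrite HK in *. assert (0 < w * d x y) by (apply Rmult_lt_0_compat; lra).
    assert (Rabs c * 1 <= Rabs c * d x y) by (apply Rmult_le_compat_l; lra).
    assert (b * 1 <= b * d x y) by (apply Rmult_le_compat_l; lra).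
    lra.
  - exists y. split; [exact Hy1|]. intros z Hz. specialize (Hy2 z Hz). unfold w in Hy2. lra.
Qed.

(** Minimality of [y] is tested against [geo y z t]. Convexity and the CN inequality leave a
    multiple of [t], which is divided out before [t] tends to 0. *)
Lemma prox_variational D phi lam x y z : clf D phi -> 0 < lam -> prox D phi lam x y -> D z ->
  d y z ^ 2 <= d x z ^ 2 - d x y ^ 2 - 2 * lam * (phi y - phi z).
Proof.
  intros Hf Hl [Hy Hmin] Hz.
  apply (arbitrarily_small_multiple _ _ (d y z ^ 2)); [apply pow2_ge_0|].
  intros t Ht.
  destruct (clf_convex _ _ Hf y z t Hy Hz ltac:(lra)) as [Hp1 Hp2].
  pose proof (Hmin _ Hp1) as Hp3. pose proof (cn_geo y z x t ltac:(lra)) as Hcn.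
  set (p := geo y z t) in *.
  assert (E : forall a, a = 2 * lam * (a / (2 * lam))) by (intros a; field; lra).
  pose proof (E (d x y ^ 2)) as E1. pose proof (E (d x p ^ 2)) as E2.
  assert (2 * lam * phi y + d x y ^ 2 <= 2 * lam * phi p + d x p ^ 2) by nra.
  assert (2 * lam * phi p <= 2 * lam * ((1 - t) * phi y + t * phi z)) by
    (apply Rmult_le_compat_l; lra).
  apply Rmult_le_reg_l with t; [lra|]. nra.
Qed.

(** In the sum of the variational inequalities of [y] at [y'] and of [y'] at [y] the values of [phi]
    cancel. The quadrilateral inequality then gives [d y y' ^ 2 <= d x x' * d y y']. *)
Lemma prox_nonexpansive D phi lam x x' y y' : clf D phi -> 0 < lam ->
  prox D phi lam x y -> prox D phi lam x' y' -> d y y' <= d x x'.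
Proof.
  intros Hf Hl Hy Hy'.
  pose proof (prox_variational _ _ _ _ _ _ Hf Hl Hy (proj1 Hy')) as A.
  pose proof (prox_variational _ _ _ _ _ _ Hf Hl Hy' (proj1 Hy)) as B.
  pose proof (quadrilateral x y y' x') as Q.
  rewrite (dist_sym y' y), (dist_sym y' x') in *. rewrite (dist_sym y x') in Q.
  pose proof (dist_ge0 y y'). pose proof (dist_ge0 x x').
  destruct (Req_dec (d y y') 0); [lra|]. nra.
Qed.

(** Convertible with [cl_dom d f] when [D] is [dom f], so results about [clos] apply to [f]
    directly. *)
Definition clos (D : H -> Prop) (x : H) : Prop :=
  forall eps, 0 < eps -> exists y, D y /\ d x y < eps.

Lemma clos_self (D : H -> Prop) x : D x -> clos D x.
Proof. intros Hx eps He. exists x. rewrite dist_xx. auto. Qed.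

Lemma clos_closed (D : H -> Prop) u y : seq_lim d u y -> (forall n, clos D (u n)) -> clos D y.
Proof.
  intros Hu HD eps He. destruct (Hu (eps / 2) ltac:(lra)) as [N HN].
  specialize (HN N ltac:(lia)). destruct (HD N (eps / 2) ltac:(lra)) as [z [Hz Hz']].
  exists z. split; [exact Hz|]. pose proof (dist_tri y (u N) z). pose proof (dist_sym y (u N)). lra.
Qed.

(** The zero function with domain [clos D] encodes the indicator function of the closure, which
    brings metric projections under the theory of resolvents. *)
Lemma clf_closure D phi : clf D phi -> clf (clos D) (fun _ => 0).
Proof.
  intros Hf. split.
  - intros x y t Hx Hy Ht. split; [|lra]. intros eps He.
    destruct (Hx eps He) as [x' [Hx1 Hx2]]. destruct (Hy eps He) as [y' [Hy1 Hy2]].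
    exists (geo x' y' t). split; [now apply (clf_convex _ _ Hf)|].
    pose proof (dist_geo_geo x y x' y' t Ht) as Hg.
    destruct (Req_dec t 0) as [->|Ht0]; [lra|].
    assert (t * d y y' < t * eps) by (apply Rmult_lt_compat_l; lra).
    assert ((1 - t) * d x x' <= (1 - t) * eps) by (apply Rmult_le_compat_l; lra). lra.
  - intros u y c Hu Hc. split; [|apply (Hc 0%nat)].
    apply (clos_closed D u y Hu). intros n; apply Hc.
Qed.

(** The variational inequality at a point [z] of [D] close to [x] bounds [d x (J lam x) ^ 2] by
    [d x z ^ 2] plus [2 * lam] times a difference of values. The linear lower bound on [phi] makes
    the latter small, its term in [d x (J lam x)] being absorbed by Young's inequality. *)
Lemma prox_to_identity D phi (J : R -> H -> H) x eps : clf D phi ->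
  (forall lam, 0 < lam -> prox D phi lam x (J lam x)) -> clos D x -> 0 < eps ->
  exists del, 0 < del /\ forall lam, 0 < lam < del -> d x (J lam x) < eps.
Proof.
  intros Hf HJ Hx He.
  destruct (clf_linear_below D phi x Hf) as [b [Hb Hlow]].
  destruct (Hx (eps / 4) ltac:(lra)) as [z [Hz Hz']].
  set (K := 4 * (Rabs (phi z) + b) + 4 * b ^ 2 + 1).
  pose proof (Rabs_pos (phi z)). pose proof (Rle_abs (phi z)).
  assert (HK : 1 <= K) by (unfold K; nra).
  exists (Rmin 1 (eps ^ 2 / (2 * K))). split.
  { apply Rmin_pos; [lra|]. apply Rdiv_lt_0_compat; nra. }
  intros lam [Hl Hl'].
  assert (Hl1 : lam < 1) by (eapply Rlt_le_trans; [exact Hl' | apply Rmin_l]).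
  assert (Hl2 : lam * (2 * K) < eps ^ 2).
  { apply Rlt_div_r; [lra|]. eapply Rlt_le_trans; [exact Hl' | apply Rmin_r]. }
  specialize (HJ lam Hl).
  pose proof (prox_variational D phi lam x _ z Hf Hl HJ Hz) as HV.
  specialize (Hlow _ (proj1 HJ)). set (y := J lam x) in *.
  pose proof (dist_ge0 x y). pose proof (dist_ge0 x z). pose proof (pow2_ge_0 (d y z)).
  apply pow2_lt_inv; [lra|].
  assert (2 * lam * (phi z - phi y) <= 2 * lam * (phi z + b + b * d x y)).
  { apply Rmult_le_compat_l; lra. }
  assert (2 * lam * (b * d x y) <= 2 * lam ^ 2 * b ^ 2 + d x y ^ 2 / 2).
  { pose proof (pow2_ge_0 (2 * lam * b - d x y)). nra. }
  assert (lam ^ 2 * b ^ 2 <= lam * b ^ 2) by (pose proof (pow2_ge_0 b); nra).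
  assert (2 * lam * (phi z + b) <= 2 * lam * (Rabs (phi z) + b)) by (apply Rmult_le_compat_l; lra).
  assert (d x z ^ 2 <= eps ^ 2 / 16) by nra.
  unfold K in Hl2. nra.
Qed.

(** * Sums of convex lower semicontinuous functions *)

Fixpoint rsum (a : nat -> R) (k : nat) : R :=
  match k with O => 0 | S j => rsum a j + a j end.

Lemma rsum_le_const (a : nat -> R) c k :
  (forall j, (j < k)%nat -> c <= a j) -> INR k * c <= rsum a k.
Proof.
  induction k as [|k IH]; intros Hab; simpl rsum; [simpl; lra|].
  specialize (IH ltac:(intros; apply Hab; lia)). specialize (Hab k ltac:(lia)).
  rewrite S_INR. lra.
Qed.

Lemma rsum_term_le (a : nat -> R) c k l : (forall j, (j < k)%nat -> c <= a j) -> (l < k)%nat ->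
  a l <= rsum a k - (INR k - 1) * c.
Proof.
  induction k as [|k IH]; intros Hc Hl; [lia|]. simpl rsum. rewrite S_INR.
  destruct (Nat.eq_dec l k) as [->|Hne].
  - pose proof (rsum_le_const a c k ltac:(intros; apply Hc; lia)). lra.
  - specialize (IH ltac:(intros; apply Hc; lia) ltac:(lia)). specialize (Hc k ltac:(lia)). lra.
Qed.

(** Lower semicontinuity in negated form: failure of [D y /\ phi y <= M] expresses a value above
    [M], with value infinity outside [D]. *)
Lemma clf_eventually_above D phi u y M : clf D phi -> seq_lim d u y ->
  ~ (D y /\ phi y <= M) ->
  exists N, forall n, (N <= n)%nat -> ~ (D (u n) /\ phi (u n) <= M).
Proof.
  intros Hf Hu Hn. apply NNPP; intro Hno. apply Hn.
  assert (Hs : forall N, exists n, (N <= n)%nat /\ D (u n) /\ phi (u n) <= M).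
  { intros N. apply NNPP; intro Hc. apply Hno. exists N. intros n Hle Hd'.
    apply Hc. now exists n. }
  destruct (choice _ Hs) as [psi Hpsi].
  apply (clf_closed _ _ Hf (fun n => u (psi n))).
  - apply seq_lim_subseq; [apply Hpsi | exact Hu].
  - intros n; apply Hpsi.
Qed.

Section Family.
Context (D : nat -> H -> Prop) (phi : nat -> H -> R) (k : nat).
Context (Hf : forall j, (j < k)%nat -> clf (D j) (phi j)).

Let Dsum (y : H) : Prop := forall j, (j < k)%nat -> D j y.
Let fsum (y : H) : R := rsum (fun j => phi j y) k.

(** Each summand may be evaluated along its own sequence, as happens for the intermediate points of
    a product. The induction splits the threshold between the first summands and the last. *)
Lemma sum_eventually_above (u : nat -> nat -> H) y M :
  (forall j, (j < k)%nat -> seq_lim d (fun n => u n j) y) ->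
  ~ (Dsum y /\ fsum y <= M) ->
  exists N, forall n, (N <= n)%nat ->
    ~ ((forall j, (j < k)%nat -> D j (u n j)) /\ rsum (fun j => phi j (u n j)) k <= M).
Proof.
  unfold Dsum, fsum. clear Dsum fsum. revert M Hf.
  induction k as [|i IH]; intros M Hf Hu Hn.
  - exists 0%nat. intros n _ [_ HM]. apply Hn. split; [intros; lia | exact HM].
  - set (A := forall j, (j < i)%nat -> D j y). set (s := rsum (fun j => phi j y) i).
    (* If both parts are finite they share the excess over [M] equally. If one is infinite, the
       other gets a threshold 1 below its real value and the infinite part takes the rest. *)
    assert (HM : exists M1 M2, M <= M1 + M2 /\ ~ (A /\ s <= M1) /\ ~ (D i y /\ phi i y <= M2)).
    { destruct (classic A) as [HA|HA].
      - destruct (classic (D i y)) as [HD|HD].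
        + assert (M < s + phi i y).
          { apply Rnot_le_lt; intro Hle. apply Hn. split; [|exact Hle].
            intros j Hj. destruct (Nat.eq_dec j i) as [->|]; [exact HD | apply HA; lia]. }
          exists (s - (s + phi i y - M) / 2), (phi i y - (s + phi i y - M) / 2).
          repeat split; [lra | intros [_ Hx]; lra | intros [_ Hx]; lra].
        + exists (s - 1), (M - (s - 1)). repeat split; [lra | intros [_ Hx]; lra | tauto].
      - exists (M - (phi i y - 1)), (phi i y - 1). repeat split; [lra | tauto | intros [_ Hx]; lra]. }
    destruct HM as [M1 [M2 [HM [H1 H2]]]].
    destruct (IH M1) as [N1 HN1]; [intros; apply Hf; lia | intros; apply Hu; lia | exact H1 |].
    destruct (clf_eventually_above _ _ (fun n => u n i) y M2 (Hf i ltac:(lia)) (Hu i ltac:(lia)) H2)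
      as [N2 HN2].
    exists (N1 + N2)%nat. intros n Hle [HD Hs]. simpl in Hs.
    apply (HN1 n ltac:(lia)). split; [intros; apply HD; lia|].
    assert (M2 < phi i (u n i)); [|lra].
    apply Rnot_le_lt; intro Hc. apply (HN2 n ltac:(lia)). split; [apply HD; lia | exact Hc].
Qed.

Lemma clf_sum : clf Dsum fsum.
Proof.
  split.
  - intros x y t Hx Hy Ht. split.
    + intros j Hj. apply (clf_convex _ _ (Hf j Hj)); auto.
    + unfold fsum, Dsum in *. clear Dsum fsum. revert Hf Hx Hy. induction k as [|i IH]; intros Hf Hx Hy; simpl; [lra|].
      destruct (clf_convex _ _ (Hf i ltac:(lia)) x y t) as [_ Hi]; [apply Hx; lia | apply Hy; lia | lra |].
      specialize (IH ltac:(intros; apply Hf; lia) ltac:(intros; apply Hx; lia) ltac:(intros; apply Hy; lia)).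
      lra.
  - intros u y c Hu Hc. apply NNPP; intro Hn.
    destruct (sum_eventually_above (fun n _ => u n) y c (fun _ _ => Hu) Hn) as [N HN].
    apply (HN N ltac:(lia)). apply Hc.
Qed.

Lemma penalized_sum_closed (p : nat -> H) (q : nat -> nat -> H) x y w c : 0 < w ->
  seq_lim d p y -> (forall j, (j < k)%nat -> seq_lim d (fun n => q n j) y) ->
  (forall n j, (j < k)%nat -> D j (q n j)) ->
  (forall n, d x (p n) ^ 2 + w * rsum (fun j => phi j (q n j)) k <= c) ->
  Dsum y /\ d x y ^ 2 + w * fsum y <= c.
Proof.
  intros Hw Hp Hq HD Hc.
  assert (Hdel : forall del, 0 < del -> Dsum y /\ fsum y <= (c - d x y ^ 2 + del) / w).
  { intros del Hdel. apply NNPP; intro Hn.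
    destruct (sum_eventually_above q y _ Hq Hn) as [N1 HN1].
    destruct (dist_sqr_seq_lim p y x del Hp Hdel) as [N2 HN2].
    specialize (HN2 (N1 + N2)%nat ltac:(lia)). apply Rabs_def2 in HN2.
    apply (HN1 (N1 + N2)%nat ltac:(lia)). split; [apply HD|].
    specialize (Hc (N1 + N2)%nat). apply Rle_div_r; [exact Hw | lra]. }
  split; [apply (Hdel 1); lra|].
  apply (arbitrarily_small_multiple _ _ 1); [lra|]. intros t Ht.
  destruct (Hdel t ltac:(lra)) as [_ Hs]. apply Rle_div_r in Hs; [lra | exact Hw].
Qed.

(** The points [p] admitting such a [q] at precision [/ (INR N + 1)] form nested sets, closed under
    midpoints because distance, squared distance and every [phi j] are convex. A limit of points of
    these sets is an exact common point. *)
Lemma approximate_consensus x w c B : 0 < w ->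
  (forall N : nat, exists p q, (forall j, (j < k)%nat -> D j (q j) /\ d p (q j) <= / (INR N + 1)) /\
     d x p <= B /\ d x p ^ 2 + w * rsum (fun j => phi j (q j)) k <= c) ->
  exists y, Dsum y /\ d x y ^ 2 + w * fsum y <= c.
Proof.
  intros Hw Hex.
  set (P := fun (N : nat) p (q : nat -> H) =>
    (forall j, (j < k)%nat -> D j (q j) /\ d p (q j) <= / (INR N + 1)) /\
    d x p ^ 2 + w * rsum (fun j => phi j (q j)) k <= c).
  destruct (nested_convex_sets (fun N p => exists q, P N p q) x B) as [p [y [Hp Hy]]].
  - intros m n p Hmn [q [Hq Hc]]. exists q. split; [|exact Hc].
    intros j Hj. destruct (Hq j Hj). pose proof (inv_INR_anti _ _ Hmn). split; [assumption | lra].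
  - intros n p p' [q [Hq Hc]] [q' [Hq' Hc']].
    exists (fun j => geo (q j) (q' j) (1 / 2)). split.
    + intros j Hj. destruct (Hq j Hj) as [H1 H2]. destruct (Hq' j Hj) as [H1' H2']. split.
      * apply (clf_convex _ _ (Hf j Hj)); auto; lra.
      * pose proof (dist_geo_geo p p' (q j) (q' j) (1 / 2) ltac:(lra)). lra.
    + assert (Hs : rsum (fun j => phi j (geo (q j) (q' j) (1 / 2))) k
                 <= 1 / 2 * rsum (fun j => phi j (q j)) k + 1 / 2 * rsum (fun j => phi j (q' j)) k).
      { clear Hc Hc' P Dsum fsum Hex. revert Hf Hq Hq'. induction k as [|i IH]; intros Hf Hq Hq'; simpl; [lra|].
        specialize (IH ltac:(intros; apply Hf; lia) ltac:(intros; apply Hq; lia) ltac:(intros; apply Hq'; lia)).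
        destruct (clf_convex _ _ (Hf i ltac:(lia)) (q i) (q' i) (1 / 2)) as [_ Hi];
          [apply Hq; lia | apply Hq'; lia | lra |]. lra. }
      pose proof (cn_geo p p' x (1 / 2) ltac:(lra)). pose proof (pow2_ge_0 (d p p')).
      set (s := rsum _ k) in *. nra.
  - intros N. destruct (Hex N) as [p [q [Hq [HB Hc]]]]. exists p. split; [now exists q | exact HB].
  - destruct (choice _ Hp) as [q Hq]. exists y.
    apply (penalized_sum_closed p q x y w c Hw Hy).
    + intros j Hj. apply (seq_lim_near p); [|exact Hy]. intros eps He.
      destruct (archimed_inv eps He) as [N HN]. exists N. intros n Hn.
      specialize (HN n Hn). pose proof (proj2 (proj1 (Hq n) j Hj)). lra.
    + intros n j Hj. apply (proj1 (Hq n) j Hj).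
    + intros n. apply (proj2 (Hq n)).
Qed.

End Family.

(** * Chernoff's formula for nonexpansive maps *)

Section Chernoff.

Definition nonexpansive (F : H -> H) : Prop := forall x y, d (F x) (F y) <= d x y.

Lemma iter_nonexpansive F n : nonexpansive F -> nonexpansive (iter n F).
Proof.
  intros HF x y. induction n as [|n IH]; simpl; [lra|]. eapply Rle_trans; [apply HF | exact IH].
Qed.

Lemma iter_S_inner {F : H -> H} n x : iter (S n) F x = iter n F (F x).
Proof. induction n as [|n IH]; [reflexivity|]. simpl in *. now rewrite IH. Qed.

(* The resolvent of the "generator" [(id - F) / rho] of the discrete semigroup. *)
Definition discrete_resolvent (F : H -> H) (lam rho : R) (x y : H) : Prop :=
  y = geo x (F y) (lam / (lam + rho)).

Lemma frac_bounds lam rho : 0 < lam -> 0 < rho -> 0 < lam / (lam + rho) < 1.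
Proof.
  intros Hl Hr. split; [apply Rdiv_lt_0_compat; lra | apply Rlt_div_l; lra].
Qed.

Lemma discrete_resolvent_exists F lam rho x : nonexpansive F -> 0 < lam -> 0 < rho ->
  exists y, discrete_resolvent F lam rho x y.
Proof.
  intros HF Hl Hr. pose proof (frac_bounds lam rho Hl Hr).
  destruct (contraction_fixpoint (fun y => geo x (F y) (lam / (lam + rho))) (lam / (lam + rho)) x)
    as [y Hy]; [lra | | now exists y].
  intros y z. pose proof (dist_geo_same_origin x (F y) (F z) (lam / (lam + rho)) ltac:(lra)).
  pose proof (HF y z). nra.
Qed.

Lemma discrete_resolvent_nonexpansive F lam rho x x' y y' :
  nonexpansive F -> 0 < lam -> 0 < rho ->
  discrete_resolvent F lam rho x y -> discrete_resolvent F lam rho x' y' -> d y y' <= d x x'.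
Proof.
  intros HF Hl Hr Hy Hy'. pose proof (frac_bounds lam rho Hl Hr) as Hb.
  pose proof (dist_geo_geo x (F y) x' (F y') (lam / (lam + rho)) ltac:(lra)) as Hg.
  rewrite <- Hy, <- Hy' in Hg. pose proof (HF y y'). nra.
Qed.

(** [y] divides the geodesic from [x] to [F y] in the ratio [lam : rho]. Hence the speed
    [d y (F y) / rho] of the discrete semigroup at [y] is [d x y / lam]. *)
Lemma discrete_resolvent_dist F lam rho x y : 0 < lam -> 0 < rho ->
  discrete_resolvent F lam rho x y -> d y (F y) = rho / lam * d x y.
Proof.
  intros Hl Hr Hy. pose proof (frac_bounds lam rho Hl Hr) as Hb.
  pose proof (dist_geo_l x (F y) _ (conj (Rlt_le _ _ (proj1 Hb)) (Rlt_le _ _ (proj2 Hb)))) as E1.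
  pose proof (dist_geo_r x (F y) _ (conj (Rlt_le _ _ (proj1 Hb)) (Rlt_le _ _ (proj2 Hb)))) as E2.
  rewrite <- Hy in E1, E2. rewrite E1, E2. field. lra.
Qed.

(* The square of the bound is an exact solution of the recursion
   [c_{m+1,n+1} = rho/(lam+rho) c_{m,n+1} + lam/(lam+rho) c_{m+1,n}]. *)
Lemma kobayashi_estimate F T lam rho L x0 : nonexpansive F -> 0 < lam -> 0 < rho ->
  (forall x, discrete_resolvent F lam rho x (T x)) -> d x0 (F x0) <= rho * L ->
  forall m n, d (iter m T x0) (iter n F x0) <=
    L * sqrt ((INR m * lam - INR n * rho) ^ 2 + INR m * lam ^ 2 + INR n * rho ^ 2).
Proof.
  intros HF Hl Hr HT HL. pose proof (frac_bounds lam rho Hl Hr) as Hb.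
  assert (HL0 : 0 <= L) by (pose proof (dist_ge0 x0 (F x0)); nra).
  assert (Hn : forall n, d x0 (iter n F x0) <= INR n * (rho * L)).
  { induction n as [|n IH]; [simpl; rewrite dist_xx; lra|].
    rewrite S_INR. pose proof (dist_tri x0 (iter n F x0) (iter (S n) F x0)).
    rewrite iter_S_inner in *. pose proof (iter_nonexpansive F n HF x0 (F x0)). lra. }
  (* [T x0] lies on the geodesic from [x0] to [F (T x0)], whose length is at most
     [d x0 (F x0) + d x0 (T x0)] by nonexpansiveness. *)
  assert (Hm1 : d x0 (T x0) <= lam * L).
  { pose proof (discrete_resolvent_dist F lam rho x0 (T x0) Hl Hr (HT x0)) as E.
    pose proof (dist_geo_l x0 (F (T x0)) (lam / (lam + rho)) ltac:(lra)) as E2.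
    rewrite <- (HT x0) in E2.
    pose proof (dist_tri x0 (F x0) (F (T x0))). pose proof (HF x0 (T x0)).
    set (X := d x0 (T x0)) in *.
    assert (E3 : d x0 (F (T x0)) = (1 + rho / lam) * X) by (rewrite E2; field; lra).
    assert (rho * X <= rho * (lam * L)); [|nra].
    assert (rho / lam * X <= rho * L) by lra.
    replace (rho * X) with (lam * (rho / lam * X)) by (field; lra). nra. }
  assert (Hm : forall m, d x0 (iter m T x0) <= INR m * (lam * L)).
  { induction m as [|m IH]; [simpl; rewrite dist_xx; lra|].
    rewrite S_INR. pose proof (dist_tri x0 (iter m T x0) (iter (S m) T x0)).
    rewrite iter_S_inner in *.
    assert (HTn : nonexpansive T) by
      (intros y z; exact (discrete_resolvent_nonexpansive F lam rho _ _ _ _ HF Hl Hr (HT y) (HT z))).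
    pose proof (iter_nonexpansive T m HTn x0 (T x0)). lra. }
  assert (Hsq : forall a c, 0 <= a -> a ^ 2 <= c -> a <= sqrt c).
  { intros a c Ha Hac. rewrite <- (sqrt_pow2 a Ha). now apply sqrt_le_1_alt. }
  induction m as [|m IHm]; intros n.
  - simpl iter. eapply Rle_trans; [apply Hn|].
    replace (INR n * (rho * L)) with (L * (INR n * rho)) by ring.
    apply Rmult_le_compat_l; [exact HL0|]. pose proof (pos_INR n).
    apply Hsq; [nra|]. simpl INR. nra.
  - induction n as [|n IHn].
    + simpl (iter 0 _ _). rewrite dist_sym. eapply Rle_trans; [apply Hm|].
      replace (INR (S m) * (lam * L)) with (L * (INR (S m) * lam)) by ring.
      apply Rmult_le_compat_l; [exact HL0|]. pose proof (pos_INR (S m)).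
      apply Hsq; [nra|]. simpl (INR 0). nra.
    + specialize (IHm (S n)).
      set (y := iter m T x0) in *. change (iter (S m) T x0) with (T y) in *.
      set (v := iter n F x0) in *. change (iter (S n) F x0) with (F v) in *.
      (* [T y] is a point of the geodesic from [y] to [F (T y)]. Convexity of the distance to [F v]
         and nonexpansiveness of [F] give the recursion on the pair [(m, n)]. *)
      pose proof (HT y) as Hy. unfold discrete_resolvent in Hy. rewrite Hy at 1. clear Hy.
      rewrite dist_sym.
      eapply Rle_trans; [apply dist_geo_convex; lra|].
      pose proof (HF v (T y)) as Hv. rewrite (dist_sym v (T y)) in Hv.
      rewrite (dist_sym (F v) y).
      rewrite !S_INR in *. set (a := INR m) in *. set (b := INR n) in *.
      set (A := (a * lam - (b + 1) * rho) ^ 2 + a * lam ^ 2 + (b + 1) * rho ^ 2) in *.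
      set (B := ((a + 1) * lam - b * rho) ^ 2 + (a + 1) * lam ^ 2 + b * rho ^ 2) in *.
      set (C := ((a + 1) * lam - (b + 1) * rho) ^ 2 + (a + 1) * lam ^ 2 + (b + 1) * rho ^ 2).
      assert (Ha : 0 <= a) by apply pos_INR. assert (Hb0 : 0 <= b) by apply pos_INR.
      assert (HA : 0 <= A).
      { pose proof (pow2_ge_0 (a * lam - (b + 1) * rho)). pose proof (pow2_ge_0 lam). pose proof (pow2_ge_0 rho).
        unfold A. nra. }
      assert (HB : 0 <= B).
      { pose proof (pow2_ge_0 ((a + 1) * lam - b * rho)). pose proof (pow2_ge_0 lam). pose proof (pow2_ge_0 rho).
        unfold B. nra. }
      assert (E : (1 - lam / (lam + rho)) * A + lam / (lam + rho) * B = C).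
      { unfold A, B, C. field. lra. }
      set (be := lam / (lam + rho)) in *.
      apply Rle_trans with (L * ((1 - be) * sqrt A + be * sqrt B)).
      { nra. }
      (* What remains is concavity of the square root. *)
      apply Rmult_le_compat_l; [exact HL0|]. pose proof (sqrt_pos A). pose proof (sqrt_pos B).
      apply Hsq; [nra|]. rewrite <- E.
      rewrite <- (pow2_sqrt A HA) at 2. rewrite <- (pow2_sqrt B HB) at 2.
      assert (0 <= be * (1 - be) * (sqrt A - sqrt B) ^ 2).
      { apply Rmult_le_pos; [nra | apply pow2_ge_0]. }
      nra.
Qed.

Context (D : H -> Prop) (phi : H -> R) (Hf : clf D phi).
Context (J : R -> H -> H) (HJ : forall lam x, 0 < lam -> prox D phi lam x (J lam x)).
Context (F : R -> H -> H) (HF : forall rho, 0 < rho -> nonexpansive (F rho)).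
(** Convergence of the discrete resolvents is the only link between [F] and [J]. *)
Context (HR : forall lam x eps, 0 < lam -> 0 < eps -> exists del, 0 < del /\
  forall rho y, 0 < rho < del -> discrete_resolvent (F rho) lam rho x y -> d y (J lam x) < eps).

(** The error made at each stage is carried through the later ones by nonexpansiveness of [T]. As
    [del] depends on [m], the estimate below fixes [m] before [n]. *)
Lemma iterated_resolvent_cv lam m x eps : 0 < lam -> 0 < eps -> exists del, 0 < del /\
  forall rho T, 0 < rho < del -> (forall y, discrete_resolvent (F rho) lam rho y (T y)) ->
    d (iter m T x) (iter m (J lam) x) < eps.
Proof.
  intros Hl. revert eps. induction m as [|m IH]; intros eps He.
  - exists 1. split; [lra|]. intros. simpl. now rewrite dist_xx.
  - destruct (IH (eps / 2) ltac:(lra)) as [d1 [Hd1 H1]].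
    destruct (HR lam (iter m (J lam) x) (eps / 2) Hl ltac:(lra)) as [d2 [Hd2 H2]].
    exists (Rmin d1 d2). split; [now apply Rmin_pos|]. intros rho T [Hr Hr'] HT. simpl.
    pose proof (Rmin_l d1 d2). pose proof (Rmin_r d1 d2).
    specialize (H1 rho T ltac:(lra) HT).
    specialize (H2 rho _ ltac:(lra) (HT (iter m (J lam) x))).
    pose proof (dist_tri (T (iter m T x)) (T (iter m (J lam) x)) (J lam (iter m (J lam) x))).
    pose proof (discrete_resolvent_nonexpansive (F rho) lam rho _ _ _ _ (HF rho Hr) Hl Hr
      (HT (iter m T x)) (HT (iter m (J lam) x))).
    lra.
Qed.

(* Starting from [x0], a resolvent of [F], instead of [x] makes [d x0 (F x0) / rho] bounded as
   [rho -> 0]. *)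
Lemma chernoff_estimate t x eps : 0 < t -> clos D x -> 0 < eps ->
  exists M, forall m, (M <= m)%nat -> exists N, forall n, (N <= n)%nat ->
    d (iter n (F (t / INR n)) x) (iter m (J (t / INR m)) x) < eps.
Proof.
  intros Ht Hx He.
  destruct (prox_to_identity D phi J x (eps / 16) Hf (fun lam => HJ lam x) Hx ltac:(lra))
    as [del0 [Hdel0 Hid]].
  set (l0 := del0 / 2). assert (Hl0 : 0 < l0) by (unfold l0; lra).
  specialize (Hid l0 ltac:(unfold l0; lra)).
  (* [L] will bound [d x0 (F rho x0) / rho], which equals [d x x0 / l0]. The choice of [q] makes
     Kobayashi's bound [L * t * sqrt (/ INR m + / INR n)] smaller than [eps / 8]. *)
  set (L := eps / 8 / l0). assert (HL : 0 < L) by (unfold L; apply Rdiv_lt_0_compat; lra).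
  set (q := (eps / 8) ^ 2 / (2 * t ^ 2 * L ^ 2)).
  assert (Hq : 0 < q).
  { unfold q. apply Rdiv_lt_0_compat; [apply pow_lt; lra|].
    pose proof (pow_lt t 2 Ht). pose proof (pow_lt L 2 HL). nra. }
  destruct (archimed_inv q Hq) as [M HM].
  (* The successor compensates for the [+ 1] in [archimed_inv] and excludes [m = 0]. *)
  exists (S M). intros m Hm.
  assert (HmM : forall p, (S M <= p)%nat -> 0 < INR p /\ / INR p < q).
  { intros p Hp. destruct p as [|p]; [lia|]. specialize (HM p ltac:(lia)). rewrite S_INR.
    pose proof (pos_INR p). split; lra. }
  destruct (HmM m Hm) as [Hmp Hmq].
  set (lam := t / INR m). assert (Hl : 0 < lam) by (apply Rdiv_lt_0_compat; lra).
  destruct (HR l0 x (eps / 16) Hl0 ltac:(lra)) as [d1 [Hd1 H1]].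
  destruct (iterated_resolvent_cv lam m x (eps / 8) Hl ltac:(lra)) as [d2 [Hd2 H2]].
  destruct (archimed_inv (Rmin d1 d2 / t)) as [N HN].
  { apply Rdiv_lt_0_compat; [now apply Rmin_pos | exact Ht]. }
  exists (S (M + N)). intros n Hn.
  destruct (HmM n ltac:(lia)) as [Hnp Hnq].
  set (rho := t / INR n). assert (Hr : 0 < rho) by (apply Rdiv_lt_0_compat; lra).
  assert (Hr' : rho < Rmin d1 d2).
  { destruct n as [|n]; [lia|]. specialize (HN n ltac:(lia)). rewrite <- S_INR in HN.
    apply Rlt_div_r in HN; [|exact Ht]. unfold rho, Rdiv. lra. }
  pose proof (Rmin_l d1 d2). pose proof (Rmin_r d1 d2).
  pose proof (HF rho Hr) as HFr.
  destruct (discrete_resolvent_exists (F rho) l0 rho x HFr Hl0 Hr) as [x0 Hx0].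
  destruct (choice _ (fun y => discrete_resolvent_exists (F rho) lam rho y HFr Hl Hr)) as [T HT].
  specialize (H1 rho x0 ltac:(lra) Hx0). specialize (H2 rho T ltac:(lra) HT).
  assert (Hxx0 : d x x0 < eps / 8).
  { pose proof (dist_tri x (J l0 x) x0). rewrite (dist_sym x0) in H1. lra. }
  assert (HL' : d x0 (F rho x0) <= rho * L).
  { rewrite (discrete_resolvent_dist (F rho) l0 rho x x0 Hl0 Hr Hx0).
    unfold L. replace (rho / l0 * d x x0) with (rho * (d x x0 / l0)) by (field; lra).
    apply Rmult_le_compat_l; [lra|]. apply Rmult_le_compat_r; [|lra].
    left; apply Rinv_0_lt_compat; lra. }
  pose proof (kobayashi_estimate (F rho) T lam rho L x0 HFr Hl Hr HT HL' m n) as HK.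
  (* Both products have run for total time [t]. *)
  replace (INR m * lam - INR n * rho) with 0 in HK by (unfold lam, rho; field; lra).
  assert (HK2 : L * sqrt (0 ^ 2 + INR m * lam ^ 2 + INR n * rho ^ 2) < eps / 8).
  { assert (Es : 0 ^ 2 + INR m * lam ^ 2 + INR n * rho ^ 2 = t ^ 2 * (/ INR m + / INR n)) by
      (unfold lam, rho; field; lra).
    assert (Hlt : t ^ 2 * (/ INR m + / INR n) < (eps / 8 / L) ^ 2).
    { apply Rlt_le_trans with (t ^ 2 * (2 * q)).
      - apply Rmult_lt_compat_l; [apply pow_lt; exact Ht | lra].
      - apply Req_le. unfold q. field. lra. }
    rewrite Es. assert (He8 : 0 <= eps / 8 / L) by (left; apply Rdiv_lt_0_compat; lra).
    assert (Hsq : sqrt (t ^ 2 * (/ INR m + / INR n)) < eps / 8 / L).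
    { rewrite <- (sqrt_pow2 _ He8). apply sqrt_lt_1_alt. split; [|exact Hlt].
      apply Rmult_le_pos; [apply pow2_ge_0|]. pose proof (Rinv_0_lt_compat _ Hmp).
      pose proof (Rinv_0_lt_compat _ Hnp). lra. }
    apply Rlt_div_r in Hsq; [lra | exact HL]. }
  assert (HTn : nonexpansive T) by
    (intros y z; exact (discrete_resolvent_nonexpansive (F rho) lam rho _ _ _ _ HFr Hl Hr (HT y) (HT z))).
  (* Four errors of at most [eps / 8] add up: replacing [x] by [x0] under [F], Kobayashi's estimate,
     returning from [x0] to [x] under [T], and passing from [T] to [J lam]. *)
  pose proof (iter_nonexpansive _ n HFr x x0). pose proof (iter_nonexpansive _ m HTn x0 x) as HTm.
  rewrite (dist_sym x0 x) in HTm.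
  pose proof (dist_tri (iter n (F rho) x) (iter n (F rho) x0) (iter m (J lam) x)).
  pose proof (dist_tri (iter n (F rho) x0) (iter m T x0) (iter m (J lam) x)).
  pose proof (dist_tri (iter m T x0) (iter m T x) (iter m (J lam) x)).
  rewrite (dist_sym (iter n (F rho) x0) (iter m T x0)) in *.
  lra.
Qed.

(** Two iterates of [J] are compared through one iterate of [F] with a large index, so they form a
    Cauchy sequence. Its limit then attracts the iterates of [F] as well. *)
Theorem chernoff t x : 0 < t -> clos D x ->
  exists s, seq_lim d (fun n => iter n (F (t / INR n)) x) s /\
            seq_lim d (fun n => iter n (J (t / INR n)) x) s.
Proof.
  intros Ht Hx.
  assert (Hc : cauchy d (fun n => iter n (J (t / INR n)) x)).
  { intros eps He. destruct (chernoff_estimate t x (eps / 2) Ht Hx ltac:(lra)) as [M HM].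
    exists M. intros m n Hm Hn.
    destruct (HM m Hm) as [N1 H1]. destruct (HM n Hn) as [N2 H2].
    specialize (H1 (N1 + N2)%nat ltac:(lia)). specialize (H2 (N1 + N2)%nat ltac:(lia)).
    set (v := iter (N1 + N2) _ x) in *.
    pose proof (dist_tri (iter m (J (t / INR m)) x) v (iter n (J (t / INR n)) x)).
    rewrite (dist_sym _ v) in *. lra. }
  destruct (proj1 (proj2 Hd) _ Hc) as [s Hs]. exists s. split; [|exact Hs].
  intros eps He. destruct (chernoff_estimate t x (eps / 2) Ht Hx ltac:(lra)) as [M HM].
  destruct (Hs (eps / 2) ltac:(lra)) as [M' HM'].
  destruct (HM (M + M')%nat ltac:(lia)) as [N HN]. specialize (HM' (M + M')%nat ltac:(lia)).
  exists N. intros n Hn. specialize (HN n Hn). cbv beta in *.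
  pose proof (dist_tri (iter n (F (t / INR n)) x) (iter (M + M') (J (t / INR (M + M'))) x) s). lra.
Qed.

End Chernoff.

(** * Resolvents of compositions *)

Fixpoint comp (T : nat -> H -> H) (k : nat) (x : H) : H :=
  match k with O => x | S j => T j (comp T j x) end.

Lemma comp_nonexpansive T k :
  (forall j, (j < k)%nat -> nonexpansive (T j)) -> nonexpansive (comp T k).
Proof.
  induction k as [|k IH]; intros HT x y; simpl; [lra|].
  eapply Rle_trans; [apply HT; lia | apply IH; intros; apply HT; lia].
Qed.

Lemma common_bound (P : nat -> R -> Prop) k :
  (forall j b b', (j < k)%nat -> P j b -> b <= b' -> P j b') ->
  (forall j, (j < k)%nat -> exists b, P j b) ->
  exists b, 0 <= b /\ forall j, (j < k)%nat -> P j b.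
Proof.
  induction k as [|k IH]; intros Hup Hex.
  - exists 0. split; [lra | intros; lia].
  - destruct IH as [b [Hb Hb']]; [intros; eapply Hup; eauto; lia | intros; apply Hex; lia |].
    destruct (Hex k ltac:(lia)) as [c Hc].
    exists (Rmax b c). pose proof (Rmax_l b c). split; [lra|]. intros j Hj.
    destruct (Nat.eq_dec j k) as [->|].
    + eapply Hup; [lia | exact Hc | apply Rmax_r].
    + eapply Hup; [lia | apply Hb'; lia | apply Rmax_l].
Qed.

Section Splitting.
Context (D : nat -> H -> Prop) (phi : nat -> H -> R) (k : nat).
Context (Hf : forall j, (j < k)%nat -> clf (D j) (phi j)).

Let Dsum (y : H) : Prop := forall j, (j < k)%nat -> D j y.
Let fsum (y : H) : R := rsum (fun j => phi j y) k.

Context (J : R -> H -> H) (HJ : forall lam x, 0 < lam -> prox Dsum fsum lam x (J lam x)).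
(** [G rho j] is an abstract step and [e j rho y] the length whose square is gained in its
    variational inequality; both product formulas are instances. *)
Context (G : R -> nat -> H -> H) (e : nat -> R -> H -> R).
Context (HGn : forall rho j, 0 < rho -> (j < k)%nat -> nonexpansive (G rho j)).
Context (HGD : forall rho j y, 0 < rho -> (j < k)%nat -> D j (G rho j y)).
Context (HGV : forall rho j y z, 0 < rho -> (j < k)%nat -> D j z ->
  d (G rho j y) z ^ 2 <=
  d y z ^ 2 - 2 * rho * (phi j (G rho j y) - phi j z) - e j rho y ^ 2).

(** The one-step inequalities telescope along the chain. *)
Lemma chain_variational rho y z : 0 < rho -> Dsum z ->
  d (comp (G rho) k y) z ^ 2 <= d y z ^ 2
    - 2 * rho * (rsum (fun j => phi j (comp (G rho) (S j) y)) k - fsum z)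
    - rsum (fun j => e j rho (comp (G rho) j y) ^ 2) k.
Proof.
  intros Hr. unfold Dsum, fsum. clear HJ J Dsum fsum.
  revert HGV. clear HGn HGD Hf. induction k as [|i IH]; intros HV Hz; cbn [comp rsum]; [lra|].
  specialize (IH ltac:(intros; apply HV; auto; lia) ltac:(intros; apply Hz; lia)).
  pose proof (HV rho i (comp (G rho) i y) z Hr ltac:(lia) (Hz i ltac:(lia))).
  cbn [comp] in IH. lra.
Qed.

Lemma discrete_resolvent_variational lam rho x y z : 0 < lam -> 0 < rho -> Dsum z ->
  discrete_resolvent (comp (G rho) k) lam rho x y ->
  d y z ^ 2 + d x y ^ 2 + 2 * lam * rsum (fun j => phi j (comp (G rho) (S j) y)) k
    + lam / rho * rsum (fun j => e j rho (comp (G rho) j y) ^ 2) k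
  <= d x z ^ 2 + 2 * lam * fsum z.
Proof.
  intros Hl Hr Hz Hy. pose proof (frac_bounds lam rho Hl Hr) as Hb.
  pose proof (chain_variational rho y z Hr Hz) as HV.
  set (Fy := comp (G rho) k y) in *.
  set (s := rsum (fun j => phi j _) k) in *. set (es := rsum (fun j => e j rho _ ^ 2) k) in *.
  pose proof (cn_geo x Fy z (lam / (lam + rho)) ltac:(lra)) as Hcn.
  pose proof (dist_geo_l x Fy (lam / (lam + rho)) ltac:(lra)) as Hx.
  unfold discrete_resolvent in Hy. fold Fy in Hy. rewrite <- Hy in Hcn, Hx.
  assert (HW : d x Fy = (lam + rho) / lam * d x y) by (rewrite Hx; field; lra).
  rewrite HW in Hcn. clear HW Hx Hy.
  rewrite (dist_sym z y), (dist_sym z x), (dist_sym z Fy) in Hcn.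
  (* This is the CN inequality on the geodesic from [x] to [Fy], multiplied by [lam + rho]. Once
     [E3] bounds [d Fy z], the terms [lam * d y z ^ 2] cancel and what is left can be divided by
     [rho]. *)
  assert (E : (lam + rho) * d y z ^ 2 <=
    rho * d x z ^ 2 + lam * d Fy z ^ 2 - rho * (lam + rho) / lam * d x y ^ 2).
  { replace (rho * d x z ^ 2 + lam * d Fy z ^ 2 - rho * (lam + rho) / lam * d x y ^ 2)
      with ((lam + rho) * ((1 - lam / (lam + rho)) * d x z ^ 2 + lam / (lam + rho) * d Fy z ^ 2
             - lam / (lam + rho) * (1 - lam / (lam + rho)) * ((lam + rho) / lam * d x y) ^ 2))
      by (field; lra).
    apply Rmult_le_compat_l; lra. }
  assert (E2 : rho * d x y ^ 2 <= rho * (lam + rho) / lam * d x y ^ 2).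
  { apply Rmult_le_compat_r; [apply pow2_ge_0|]. apply Rle_div_r; [lra|]. nra. }
  assert (E3 : lam * d Fy z ^ 2 <= lam * (d y z ^ 2 - 2 * rho * (s - fsum z) - es)) by
    (apply Rmult_le_compat_l; lra).
  apply Rmult_le_reg_l with rho; [lra|].
  replace (rho * (d y z ^ 2 + d x y ^ 2 + 2 * lam * s + lam / rho * es))
    with (rho * d y z ^ 2 + rho * d x y ^ 2 + 2 * lam * rho * s + lam * es) by (field; lra).
  lra.
Qed.

(** Linear lower bounds on the [phi j] limit how far one step can move away from [z]. Inserted into
    the inequality for [y], they give a quadratic inequality for [d z y]. *)
Lemma chain_bounded lam x z : 0 < lam -> Dsum z ->
  exists B, 0 <= B /\ forall rho y, 0 < rho <= 1 ->
    discrete_resolvent (comp (G rho) k) lam rho x y ->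
    forall j, (j <= k)%nat -> d z (comp (G rho) j y) <= B.
Proof.
  intros Hl Hz.
  destruct (common_bound (fun j b => forall y, D j y -> - b * (1 + d z y) <= phi j y) k)
    as [b [Hb Hlow]].
  { intros j b b' _ Hb Hbb y Hy. pose proof (dist_ge0 z y). specialize (Hb y Hy). nra. }
  { intros j Hj. destruct (clf_linear_below _ _ z (Hf j Hj)) as [b [_ Hb]]. now exists b. }
  destruct (common_bound (fun j c => phi j z <= c) k) as [c [Hc Hup]].
  { intros; lra. } { intros j _. exists (phi j z). lra. }
  (* Completing the square in one step gives [(d z w' - b) ^ 2 <= (d z w + K) ^ 2], so a step adds
     at most [K + b] to the distance from [z]. *)
  set (K := 2 * (c + b) + b ^ 2 + 1).
  assert (HK : 1 <= K) by (unfold K; nra).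
  assert (Hstep : forall rho y, 0 < rho <= 1 -> forall j, (j <= k)%nat ->
    d z (comp (G rho) j y) <= d z y + INR j * (K + b)).
  { intros rho y Hr. induction j as [|j IH]; intros Hj; [simpl; lra|].
    specialize (IH ltac:(lia)). rewrite S_INR. cbn [comp].
    pose proof (HGV rho j (comp (G rho) j y) z ltac:(lra) ltac:(lia) (Hz j ltac:(lia))) as HV.
    pose proof (Hlow j ltac:(lia) _ (HGD rho j (comp (G rho) j y) ltac:(lra) ltac:(lia))) as Hlj.
    specialize (Hup j ltac:(lia)).
    set (w := comp (G rho) j y) in *. set (w' := G rho j w) in *.
    rewrite (dist_sym w' z), (dist_sym w z) in HV.
    pose proof (dist_ge0 z w). pose proof (dist_ge0 z w').
    pose proof (pow2_ge_0 (e j rho w)).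
    assert (0 <= b * d z w') by (apply Rmult_le_pos; lra).
    assert (2 * rho * (phi j z - phi j w') <= 2 * (c + b + b * d z w')).
    { apply Rle_trans with (2 * rho * (c + b + b * d z w')); [apply Rmult_le_compat_l; lra|].
      apply Rmult_le_compat_r; lra. }
    assert ((d z w' - b) ^ 2 <= (d z w + K) ^ 2).
    { assert (0 <= d z w * K) by (apply Rmult_le_pos; lra). unfold K in *. nra. }
    assert (d z w' - b <= d z w + K) by (apply pow2_le_inv; lra).
    lra. }
  set (C := INR k * (K + b)).
  assert (HC : 0 <= C) by (apply Rmult_le_pos; [apply pos_INR | lra]).
  set (Q := 2 * lam * (INR k * b)).
  assert (HQ : 0 <= Q).
  { unfold Q. pose proof (pos_INR k). repeat apply Rmult_le_pos; lra. }
  set (P := Rabs (d x z ^ 2 + 2 * lam * fsum z) + Q * (1 + C)).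
  assert (HP : 0 <= P).
  { unfold P. pose proof (Rabs_pos (d x z ^ 2 + 2 * lam * fsum z)). nra. }
  exists (1 + P + Q + C). split; [lra|]. intros rho y Hr Hy j Hj.
  pose proof (discrete_resolvent_variational lam rho x y z Hl ltac:(lra) Hz Hy) as HV.
  assert (Hes : 0 <= rsum (fun j => e j rho (comp (G rho) j y) ^ 2) k).
  { replace 0 with (INR k * 0) by ring. apply rsum_le_const. intros. apply pow2_ge_0. }
  assert (Hs : INR k * (- b * (1 + (d z y + C))) <= rsum (fun j => phi j (comp (G rho) (S j) y)) k).
  { apply rsum_le_const. intros i Hi.
    eapply Rle_trans; [|apply Hlow; [lia | apply HGD; [lra | lia]]].
    assert (d z (comp (G rho) (S i) y) <= d z y + C).
    { eapply Rle_trans; [apply Hstep; [lra | lia]|]. apply Rplus_le_compat_l.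
      apply Rmult_le_compat_r; [lra | apply le_INR; lia]. }
    cbn [comp] in *. apply Rmult_le_compat_neg_l; lra. }
  set (s := rsum (fun j => phi j _) k) in *. set (es := rsum (fun j => e j rho _ ^ 2) k) in *.
  assert (0 <= lam / rho * es).
  { apply Rmult_le_pos; [|exact Hes]. apply Rdiv_le_0_compat; lra. }
  assert (2 * lam * (INR k * (- b * (1 + (d z y + C)))) <= 2 * lam * s) by
    (apply Rmult_le_compat_l; lra).
  pose proof (pow2_ge_0 (d x y)). pose proof (Rle_abs (d x z ^ 2 + 2 * lam * fsum z)).
  rewrite (dist_sym y z) in HV.
  assert (HY : d z y ^ 2 <= P + Q * d z y) by (unfold P, Q; lra).
  assert (d z y <= 1 + P + Q).
  { pose proof (dist_ge0 z y). apply Rnot_lt_le; intro Hlt.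
    assert (0 <= P * (d z y - 1)) by (apply Rmult_le_pos; lra).
    assert ((1 + P + Q) * d z y <= d z y * d z y) by (apply Rmult_le_compat_r; lra). nra. }
  assert (INR j * (K + b) <= C).
  { apply Rmult_le_compat_r; [lra | apply le_INR; lia]. }
  specialize (Hstep rho y Hr j Hj). lra.
Qed.

(** On the ball from [chain_bounded] every [phi j] is bounded below, so the bound on their sum
    controls each value from above. The factor [lam / rho] in front of the squared errors makes
    these of order [rho]. *)
Lemma splitting_bounds lam x z : 0 < lam -> Dsum z ->
  exists B, 0 <= B /\ forall rho y, 0 < rho <= 1 ->
    discrete_resolvent (comp (G rho) k) lam rho x y ->
    d z y <= B /\
    forall j, (j < k)%nat ->
      d z (comp (G rho) (S j) y) <= B /\ phi j (comp (G rho) (S j) y) <= B /\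
      e j rho (comp (G rho) j y) ^ 2 <= rho * B.
Proof.
  intros Hl Hz. destruct (chain_bounded lam x z Hl Hz) as [B [HB0 HB]].
  destruct (common_bound (fun j m => forall y, D j y -> d z y <= B -> - m <= phi j y) k)
    as [m [Hm Hlow]].
  { intros j m m' _ Hm Hmm y Hy Hd'. specialize (Hm y Hy Hd'). lra. }
  { intros j Hj. destruct (clf_bounded_below _ _ z B (Hf j Hj)) as [m Hm]. exists (- m).
    intros y Hy Hd'. specialize (Hm y Hy Hd'). lra. }
  set (g := Rabs (d x z ^ 2 + 2 * lam * fsum z)).
  assert (Hg : d x z ^ 2 + 2 * lam * fsum z <= g) by apply Rle_abs.
  assert (Hg0 : 0 <= g) by apply Rabs_pos.
  pose proof (pos_INR k) as Hk.
  set (B1 := g / (2 * lam) + INR k * m). set (B2 := (g + 2 * lam * (INR k * m)) / lam).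
  assert (Hkm : 0 <= INR k * m) by nra.
  assert (HB1 : 0 <= B1) by (apply Rplus_le_le_0_compat; [apply Rdiv_le_0_compat; lra | lra]).
  assert (HB2 : 0 <= B2).
  { apply Rdiv_le_0_compat; [|lra]. assert (0 <= 2 * lam * (INR k * m)) by (apply Rmult_le_pos; lra). lra. }
  exists (B + B1 + B2). split; [lra|]. intros rho y Hr Hy.
  specialize (HB rho y Hr Hy). split; [specialize (HB 0%nat ltac:(lia)); simpl in HB; lra|].
  intros l Hl'. split; [specialize (HB (S l) ltac:(lia)); lra|].
  pose proof (discrete_resolvent_variational lam rho x y z Hl ltac:(lra) Hz Hy) as HV.
  assert (Hlow' : forall j, (j < k)%nat -> - m <= phi j (comp (G rho) (S j) y)).
  { intros j Hj. apply Hlow; [exact Hj | apply HGD; [lra | exact Hj] | apply HB; lia]. }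
  pose proof (rsum_le_const _ _ k Hlow') as Hs.
  pose proof (rsum_term_le _ _ k l Hlow' Hl') as Hsl.
  assert (He0 : forall j, (j < k)%nat -> 0 <= e j rho (comp (G rho) j y) ^ 2) by
    (intros; apply pow2_ge_0).
  pose proof (rsum_le_const _ _ k He0) as Hes. pose proof (rsum_term_le _ _ k l He0 Hl') as Hel.
  cbv beta in Hsl, Hel.
  set (s := rsum (fun j => phi j _) k) in *. set (es := rsum (fun j => e j rho _ ^ 2) k) in *.
  pose proof (pow2_ge_0 (d y z)). pose proof (pow2_ge_0 (d x y)).
  assert (0 <= lam / rho * es) by (apply Rmult_le_pos; [apply Rdiv_le_0_compat; lra | lra]).
  assert (2 * lam * (INR k * - m) <= 2 * lam * s) by (apply Rmult_le_compat_l; lra).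
  split.
  - assert (s <= g / (2 * lam)) by (apply Rle_div_r; lra). unfold B1 in *. lra.
  - assert (Hes' : lam / rho * es <= g + 2 * lam * (INR k * m)) by lra.
    assert (es <= rho * B2).
    { unfold B2. replace es with (rho / lam * (lam / rho * es)) by (field; lra).
      replace (rho * ((g + 2 * lam * (INR k * m)) / lam))
        with (rho / lam * (g + 2 * lam * (INR k * m))) by (field; lra).
      apply Rmult_le_compat_l; [apply Rdiv_le_0_compat; lra | exact Hes']. }
    assert (0 <= rho * B) by nra. assert (0 <= rho * B1) by nra. lra.
Qed.

Lemma prox_not_improvable lam x eps y : 0 < lam -> 0 < eps -> Dsum y ->
  ~ d x y ^ 2 + 2 * lam * fsum y <= d x (J lam x) ^ 2 + 2 * lam * fsum (J lam x) - eps ^ 2.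
Proof.
  intros Hl He Hy Hle. destruct (HJ lam x Hl) as [_ Hmin]. specialize (Hmin y Hy).
  apply (Rmult_le_compat_l (2 * lam)) in Hmin; [|lra].
  replace (2 * lam * (fsum (J lam x) + d x (J lam x) ^ 2 / (2 * lam)))
    with (2 * lam * fsum (J lam x) + d x (J lam x) ^ 2) in Hmin by (field; lra).
  replace (2 * lam * (fsum y + d x y ^ 2 / (2 * lam)))
    with (2 * lam * fsum y + d x y ^ 2) in Hmin by (field; lra).
  pose proof (pow_lt eps 2 He). lra.
Qed.

(** A point [y] at distance at least [eps] from [J lam x] would beat the minimal value by [eps ^ 2],
    up to evaluating the summands at the intermediate points. *)
Lemma discrete_resolvent_gap lam rho x y eps : 0 < lam -> 0 < rho -> 0 < eps ->
  discrete_resolvent (comp (G rho) k) lam rho x y -> eps <= d y (J lam x) ->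
  d x y ^ 2 + 2 * lam * rsum (fun j => phi j (comp (G rho) (S j) y)) k <=
  d x (J lam x) ^ 2 + 2 * lam * fsum (J lam x) - eps ^ 2.
Proof.
  intros Hl Hr He Hy Hge.
  pose proof (discrete_resolvent_variational lam rho x y _ Hl Hr (proj1 (HJ lam x Hl)) Hy) as HV.
  assert (0 <= rsum (fun j => e j rho (comp (G rho) j y) ^ 2) k).
  { replace 0 with (INR k * 0) by ring. apply rsum_le_const. intros. apply pow2_ge_0. }
  set (es := rsum (fun j => e j rho _ ^ 2) k) in *.
  assert (0 <= lam / rho * es).
  { apply Rmult_le_pos; [apply Rdiv_le_0_compat; lra | assumption]. }
  assert (eps ^ 2 <= d y (J lam x) ^ 2) by nra. lra.
Qed.

(* The [y] admit nearby points of the domains, so points nearly minimising the distance to [x]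
   under this constraint converge (CN inequality) to a competitor of [J lam x]. *)
Lemma splitting_resolvent_cv_of_step_bound lam x eps :
  (forall rho j y, d y (G rho j y) <= e j rho y) ->
  0 < lam -> 0 < eps -> exists del, 0 < del /\
  forall rho y, 0 < rho < del -> discrete_resolvent (comp (G rho) k) lam rho x y ->
    d y (J lam x) < eps.
Proof.
  intros Hstep Hl He. set (z := J lam x).
  assert (Hz : Dsum z) by apply (HJ lam x Hl).
  destruct (splitting_bounds lam x z Hl Hz) as [B [HB0 HB]].
  (* Otherwise approximate competitors of every precision would produce an exact one, contradicting
     minimality of [z]. The resulting [N] is independent of [rho]. *)
  assert (HN : exists N : nat, ~ exists p q,
    (forall j, (j < k)%nat -> D j (q j) /\ d p (q j) <= / (INR N + 1)) /\
    d x p <= d x z + B /\ d x p ^ 2 + 2 * lam * rsum (fun j => phi j (q j)) k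
      <= d x z ^ 2 + 2 * lam * fsum z - eps ^ 2).
  { apply not_all_ex_not. intro Hall.
    destruct (approximate_consensus D phi k Hf x (2 * lam) _ _ ltac:(lra) Hall) as [y [Hy Hc]].
    exact (prox_not_improvable lam x eps y Hl He Hy Hc). }
  destruct HN as [N HN]. pose proof (inv_INR_pos N) as HN0.
  set (eta := / (INR N + 1)) in *.
  pose proof (pos_INR k) as Hk.
  (* With [rho * B] below [del], each of the at most [k] steps moves by at most
     [eta / (INR k + 1)]. *)
  set (del := (eta / (INR k + 1)) ^ 2).
  assert (Heta : 0 < eta / (INR k + 1)) by (apply Rdiv_lt_0_compat; lra).
  exists (Rmin 1 (del / (B + 1))). split.
  { apply Rmin_pos; [lra|]. apply Rdiv_lt_0_compat; [apply pow_lt; exact Heta | lra]. }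
  intros rho y [Hr Hr'] Hy.
  assert (Hr1 : rho < 1) by (eapply Rlt_le_trans; [exact Hr' | apply Rmin_l]).
  assert (Hr2 : rho * (B + 1) < del).
  { apply Rlt_div_r; [lra|]. eapply Rlt_le_trans; [exact Hr' | apply Rmin_r]. }
  apply Rnot_le_lt; intro Hge. apply HN.
  destruct (HB rho y ltac:(lra) Hy) as [Hzy HBj].
  exists y, (fun j => comp (G rho) (S j) y). repeat split.
  - apply HGD; assumption.
  - assert (Hd' : forall i, (i <= k)%nat -> d y (comp (G rho) i y) <= INR i * (eta / (INR k + 1))).
    { induction i as [|i IH]; intros Hi; [simpl; rewrite dist_xx; lra|].
      specialize (IH ltac:(lia)). rewrite S_INR.
      pose proof (dist_tri y (comp (G rho) i y) (comp (G rho) (S i) y)).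
      pose proof (Hstep rho i (comp (G rho) i y)) as Hs. cbn [comp] in *.
      destruct (HBj i ltac:(lia)) as [_ [_ Hei]].
      assert (d (comp (G rho) i y) (G rho i (comp (G rho) i y)) <= eta / (INR k + 1)).
      { apply pow2_le_inv; [lra|]. fold del.
        pose proof (dist_ge0 (comp (G rho) i y) (G rho i (comp (G rho) i y))). nra. }
      lra. }
    eapply Rle_trans; [apply Hd'; lia|].
    assert (INR (S j) <= INR k + 1).
    { rewrite <- S_INR. apply le_INR. lia. }
    apply Rle_trans with ((INR k + 1) * (eta / (INR k + 1))).
    + apply Rmult_le_compat_r; lra.
    + apply Req_le. field. lra.
  - pose proof (dist_tri x z y). lra.
  - apply discrete_resolvent_gap; assumption.
Qed.

(* Here [e] controls the projection steps only. Compactness of sublevel sets of [phi l] gives a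
   limit of the intermediate points at stage [l]; nonexpansiveness and continuity of the flows at
   time 0 transport it to the later stages and, since [d y (F y)] tends to 0, to all of them. *)
Lemma splitting_resolvent_cv_of_compact (P : nat -> H -> H) l lam x eps :
  (forall rho j y, (j < k)%nat -> d y (P j y) <= e j rho y) ->
  (forall j y, (j < k)%nat -> clos (D j) (P j y)) ->
  (forall j u eta, (j < k)%nat -> clos (D j) u -> 0 < eta -> exists del, 0 < del /\
     forall rho, 0 < rho < del -> d (G rho j u) u < eta) ->
  (l < k)%nat ->
  (forall c B z (u : nat -> H), (forall n, D l (u n) /\ phi l (u n) <= c /\ d z (u n) <= B) ->
     exists psi y, (forall n, (psi n < psi (S n))%nat) /\ seq_lim d (fun n => u (psi n)) y) ->
  0 < lam -> 0 < eps -> exists del, 0 < del /\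
  forall rho y, 0 < rho < del -> discrete_resolvent (comp (G rho) k) lam rho x y ->
    d y (J lam x) < eps.
Proof.
  intros HPe HPc HG0 Hlk Hcpt Hl He. set (z := J lam x).
  assert (Hz : Dsum z) by apply (HJ lam x Hl).
  destruct (splitting_bounds lam x z Hl Hz) as [B [HB0 HB]].
  apply NNPP; intro Hno.
  (* The parameter and the point are paired so that one use of [choice] selects both. *)
  assert (Hseq : forall n : nat, exists ry, 0 < fst ry < / (INR n + 1) /\
    discrete_resolvent (comp (G (fst ry)) k) lam (fst ry) x (snd ry) /\ eps <= d (snd ry) z).
  { intros n. apply NNPP; intro Hc. apply Hno. exists (/ (INR n + 1)).
    split; [apply inv_INR_pos|]. intros rho y Hr Hy. apply Rnot_le_lt; intro Hle.
    apply Hc. now exists (rho, y). }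
  destruct (choice _ Hseq) as [ry Hry]. clear Hseq Hno.
  assert (Hle1 : forall n, / (INR n + 1) <= 1).
  { intros n. pose proof (inv_INR_anti 0 n ltac:(lia)) as Hi. simpl in Hi.
    rewrite Rplus_0_l, Rinv_1 in Hi. exact Hi. }
  assert (Hbd : forall n, d z (snd (ry n)) <= B /\ forall j, (j < k)%nat ->
      d z (comp (G (fst (ry n))) (S j) (snd (ry n))) <= B /\
      phi j (comp (G (fst (ry n))) (S j) (snd (ry n))) <= B /\
      e j (fst (ry n)) (comp (G (fst (ry n))) j (snd (ry n))) ^ 2 <= fst (ry n) * B).
  { intros n. destruct (Hry n) as [Hr [Hy _]]. apply HB; [|exact Hy]. specialize (Hle1 n). lra. }
  destruct (Hcpt B B z (fun n => comp (G (fst (ry n))) (S l) (snd (ry n)))) as [psi [y [Hpsi Hlim]]].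
  { intros n. destruct (Hry n) as [[Hr _] _]. destruct (proj2 (Hbd n) l Hlk) as [H1 [H2 _]].
    repeat split; [apply HGD; assumption | exact H2 | exact H1]. }
  set (r := fun n => fst (ry (psi n))). set (v := fun n => snd (ry (psi n))).
  assert (Hr : forall n, 0 < r n < / (INR n + 1)).
  { intros n. destruct (Hry (psi n)) as [[H1 H2] _]. split; [exact H1|].
    eapply Rlt_le_trans; [exact H2|]. apply inv_INR_anti, increasing_ge, Hpsi. }
  assert (Hprop : forall j, (j < k)%nat -> seq_lim d (fun n => comp (G (r n)) j (v n)) y ->
                                 seq_lim d (fun n => comp (G (r n)) (S j) (v n)) y).
  { intros j Hj Hv.
    (* The projection parts have squared length at most [r n * B], so the projected points also tend
       to [y]. This places [y] in the closure, where [HG0] applies. *)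
    assert (Hy : clos (D j) y).
    { apply (clos_closed (D j) (fun n => P j (comp (G (r n)) j (v n)))); [|intros; now apply HPc].
      apply (seq_lim_near (fun n => comp (G (r n)) j (v n))); [|exact Hv].
      intros eta Heta. destruct (archimed_inv (eta ^ 2 / (B + 1))) as [N HN].
      { apply Rdiv_lt_0_compat; [apply pow_lt; exact Heta | lra]. }
      exists N. intros n Hn. specialize (HN n Hn). apply Rlt_div_r in HN; [|lra].
      pose proof (HPe (r n) j (comp (G (r n)) j (v n)) Hj) as Hp.
      destruct (proj2 (Hbd (psi n)) j Hj) as [_ [_ Hee]]. fold (r n) (v n) in Hee.
      pose proof (dist_ge0 (comp (G (r n)) j (v n)) (P j (comp (G (r n)) j (v n)))).
      apply pow2_lt_inv; [lra|].
      eapply Rle_lt_trans; [|exact HN]. specialize (Hr n). nra. }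
    intros eta Heta. destruct (HG0 j y (eta / 2) Hj Hy ltac:(lra)) as [del [Hdel Hdel']].
    destruct (Hv (eta / 2) ltac:(lra)) as [N1 HN1]. destruct (archimed_inv del Hdel) as [N2 HN2].
    exists (N1 + N2)%nat. intros n Hn. specialize (HN1 n ltac:(lia)). specialize (HN2 n ltac:(lia)).
    specialize (Hr n). specialize (Hdel' (r n) ltac:(lra)). cbn [comp].
    pose proof (HGn (r n) j ltac:(lra) Hj (comp (G (r n)) j (v n)) y).
    pose proof (dist_tri (G (r n) j (comp (G (r n)) j (v n))) (G (r n) j y) y). lra. }
  assert (Hfrom : forall i j, (i <= j <= k)%nat -> seq_lim d (fun n => comp (G (r n)) i (v n)) y ->
                                 seq_lim d (fun n => comp (G (r n)) j (v n)) y).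
  { intros i j [Hij Hjk] Hi. induction Hij as [|j Hij IH]; [exact Hi|].
    apply Hprop; [lia|]. apply IH. lia. }
  assert (Hv : seq_lim d v y).
  { apply (seq_lim_near (fun n => comp (G (r n)) k (v n))).
    2: { apply (Hfrom (S l)); [lia | exact Hlim]. }
    intros eta Heta. pose proof (dist_ge0 x z).
    destruct (archimed_inv (eta * lam / (d x z + B + 1))) as [N HN].
    { apply Rdiv_lt_0_compat; [apply Rmult_lt_0_compat; lra | lra]. }
    exists N. intros n Hn. specialize (HN n Hn). apply Rlt_div_r in HN; [|lra].
    specialize (Hr n). rewrite dist_sym.
    rewrite (discrete_resolvent_dist (comp (G (r n)) k) lam (r n) x (v n) Hl ltac:(lra) (proj1 (proj2 (Hry (psi n))))).
    pose proof (proj1 (Hbd (psi n))) as Hzv. fold (v n) in Hzv.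
    pose proof (dist_tri x z (v n)). pose proof (dist_ge0 x (v n)).
    replace (r n / lam * d x (v n)) with (r n * d x (v n) / lam) by (field; lra).
    apply Rlt_div_l; [lra|]. eapply Rle_lt_trans; [|exact HN].
    apply Rmult_le_compat; lra. }
  destruct (penalized_sum_closed D phi k Hf v (fun n j => comp (G (r n)) (S j) (v n)) x y (2 * lam)
    (d x z ^ 2 + 2 * lam * fsum z - eps ^ 2)) as [Hy Hc].
  - lra.
  - exact Hv.
  - intros j Hj. apply (Hfrom 0%nat); [lia | exact Hv].
  - intros n j Hj. apply HGD; [apply Hr | exact Hj].
  - intros n. destruct (Hry (psi n)) as [H1 [H2 H3]].
    apply discrete_resolvent_gap; try assumption. apply Hr.
  - exact (prox_not_improvable lam x eps y Hl He Hy Hc).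
Qed.

End Splitting.

(** * The Hopf-Rinow theorem *)

Section Hopf_Rinow.

Definition relatively_compact (A : H -> Prop) : Prop :=
  forall u : nat -> H, (forall n, A (u n)) ->
    exists psi y, (forall n, (psi n < psi (S n))%nat) /\ seq_lim d (fun n => u (psi n)) y.

Lemma relatively_compact_subset (A B : H -> Prop) :
  (forall y, A y -> B y) -> relatively_compact B -> relatively_compact A.
Proof. intros HAB HB u Hu. apply HB. auto. Qed.

Lemma increasing_comp (f g : nat -> nat) :
  (forall n, (f n < f (S n))%nat) -> (forall n, (g n < g (S n))%nat) ->
  forall n, (f (g n) < f (g (S n)))%nat.
Proof. intros Hf Hg n. now apply increasing_lt. Qed.

(** Successive extractions of diameter below [/ (INR n + 1)] have a diagonal subsequence that is
    Cauchy, and completeness provides the limit. *)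
Lemma diagonal_subsequence (u : nat -> H) :
  (forall eps psi, 0 < eps -> (forall n, (psi n < psi (S n))%nat) ->
     exists chi, (forall n, (chi n < chi (S n))%nat) /\
       forall m n, d (u (psi (chi m))) (u (psi (chi n))) < eps) ->
  exists psi y, (forall n, (psi n < psi (S n))%nat) /\ seq_lim d (fun n => u (psi n)) y.
Proof.
  intros Hsub.
  set (T := {psi : nat -> nat | forall n, (psi n < psi (S n))%nat}).
  assert (Hstep : forall p : nat * T, exists s : T,
    (exists chi, (forall n, (chi n < chi (S n))%nat) /\
       forall n, proj1_sig s n = proj1_sig (snd p) (chi n)) /\
    forall m n, d (u (proj1_sig s m)) (u (proj1_sig s n)) < / (INR (fst p) + 1)).
  { intros [i [psi Hpsi]]. destruct (Hsub _ psi (inv_INR_pos i) Hpsi) as [chi [Hchi Hd']].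
    exists (exist _ (fun n => psi (chi n)) (increasing_comp psi chi Hpsi Hchi)).
    split; [now exists chi | exact Hd']. }
  destruct (choice _ Hstep) as [step Hs].
  set (s := fix s (n : nat) : T := match n with
              | O => exist (fun psi => forall n, (psi n < psi (S n))%nat) (fun n => n) (fun n => Nat.lt_succ_diag_r n)
              | S i => step (i, s i) end).
  assert (Hfac : forall m i, (i <= m)%nat -> exists chi, (forall n, (chi n < chi (S n))%nat) /\
                   forall n, proj1_sig (s m) n = proj1_sig (s i) (chi n)).
  { intros m i Him. induction Him as [|m Him [chi [Hchi IH]]].
    - exists (fun n => n). split; [intros; lia | reflexivity].
    - destruct (proj1 (Hs (m, s m))) as [chi' [Hchi' E]].
      exists (fun n => chi (chi' n)). split; [now apply increasing_comp|].
      intros n. change (s (S m)) with (step (m, s m)). rewrite E. simpl snd. apply IH. }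
  set (psi := fun n => proj1_sig (s n) n).
  assert (Hinc : forall n, (psi n < psi (S n))%nat).
  { intros n. unfold psi. destruct (Hfac (S n) n ltac:(lia)) as [chi [Hchi E]]. rewrite E.
    apply increasing_lt; [apply (proj2_sig (s n))|].
    pose proof (increasing_ge chi Hchi (S n)). lia. }
  destruct (proj1 (proj2 Hd) (fun n => u (psi n))) as [y Hy]; [|now exists psi, y].
  (* Stage [S N] is extracted with diameter below [/ (INR N + 1)], and all later diagonal terms
     belong to it. *)
  intros eps He. destruct (archimed_inv eps He) as [N HN]. exists (S N). intros m n Hm Hn.
  unfold psi. destruct (Hfac m (S N) Hm) as [chi1 [_ E1]]. destruct (Hfac n (S N) Hn) as [chi2 [_ E2]].
  rewrite E1, E2. eapply Rlt_trans; [apply (proj2 (Hs (N, s N)))|]. now apply HN.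
Qed.

Context (K : H -> Prop).
Context (Kclosed : forall u y, seq_lim d u y -> (forall n, K (u n)) -> K y).
Context (Kconvex : forall y z t, K y -> K z -> 0 <= t <= 1 -> K (geo y z t)).
Context (Klocal : forall x, K x -> exists r, 0 < r /\ relatively_compact (fun y => K y /\ d x y <= r)).

Let good (x0 : H) (r : R) : Prop := relatively_compact (fun y => K y /\ d x0 y <= r).

Lemma retract_to_ball x0 y r s : K x0 -> K y -> 0 <= r <= s -> d x0 y <= s ->
  exists v, K v /\ d x0 v <= r /\ d v y <= s - r.
Proof.
  intros Kx Ky Hr Hy. destruct (Rle_dec (d x0 y) r) as [Hle|Hgt].
  - exists y. rewrite dist_xx. repeat split; [exact Ky | exact Hle | lra].
  - assert (Ht : 0 <= r / d x0 y <= 1).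
    { split; [apply Rdiv_le_0_compat; lra | apply Rle_div_l; lra]. }
    exists (geo x0 y (r / d x0 y)). split; [now apply Kconvex|]. split.
    + rewrite dist_geo_l by exact Ht. apply Req_le. field. lra.
    + rewrite dist_geo_r by exact Ht.
      replace ((1 - r / d x0 y) * d x0 y) with (d x0 y - r) by (field; lra). lra.
Qed.

(** A sequence in the large ball is shadowed within [eps / 4] by one in a smaller ball, and a
    convergent subsequence of the shadow gives a subsequence of diameter below [eps]. *)
Lemma good_left_closed x0 s : K x0 -> 0 < s -> (forall r, r < s -> good x0 r) -> good x0 s.
Proof.
  intros Kx Hs Hgood u Hu. apply diagonal_subsequence. intros eps psi He Hpsi.
  set (r := Rmax 0 (s - eps / 4)).
  assert (Hr : 0 <= r < s /\ s - r <= eps / 4).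
  { unfold r. apply Rmax_case_strong; intros; lra. }
  assert (Hv : forall n, exists v, K v /\ d x0 v <= r /\ d v (u (psi n)) <= s - r).
  { intros n. destruct (Hu (psi n)). apply retract_to_ball; try assumption. lra. }
  destruct (choice _ Hv) as [v Hv'].
  destruct (Hgood r ltac:(lra) v) as [chi [y [Hchi Hy]]].
  { intros n. split; apply Hv'. }
  destruct (Hy (eps / 4) ltac:(lra)) as [N HN].
  exists (fun n => chi (N + n)%nat). split; [intros n; rewrite Nat.add_succ_r; apply Hchi|].
  assert (Hn : forall n, d (u (psi (chi (N + n)%nat))) y < eps / 2).
  { intros n. specialize (HN (N + n)%nat ltac:(lia)). destruct (Hv' (chi (N + n)%nat)) as [_ [_ H1]].
    rewrite dist_sym in H1.
    pose proof (dist_tri (u (psi (chi (N + n)%nat))) (v (chi (N + n)%nat)) y). lra. }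
  intros m n. pose proof (Hn m). pose proof (Hn n) as H2. rewrite dist_sym in H2.
  pose proof (dist_tri (u (psi (chi (N + m)%nat))) y (u (psi (chi (N + n)%nat)))). lra.
Qed.

(** As with a Lebesgue number, compactness of the ball of radius [s] gives one radius that is good
    at all of its points. A sequence slightly outside is retracted to this ball, and its tail stays
    in a good ball around the limit of the retracted points. *)
Lemma good_right_open x0 s : K x0 -> 0 <= s -> good x0 s -> exists del, 0 < del /\ good x0 (s + del).
Proof.
  intros Kx Hs Hgood.
  assert (Hunif : exists del, 0 < del /\ forall p, K p -> d x0 p <= s -> good p del).
  { apply NNPP; intro Hno.
    assert (Hseq : forall n : nat, exists p, (K p /\ d x0 p <= s) /\ ~ good p (/ (INR n + 1))).
    { intros n. apply NNPP; intro Hc. apply Hno. exists (/ (INR n + 1)).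
      split; [apply inv_INR_pos|]. intros p Kp Hp. apply NNPP; intro Hg. apply Hc. now exists p. }
    destruct (choice _ Hseq) as [p Hp].
    destruct (Hgood p (fun n => proj1 (Hp n))) as [psi [y [Hpsi Hy]]].
    assert (Ky : K y) by (apply (Kclosed _ _ Hy); intros; apply (proj1 (Hp _))).
    destruct (Klocal y Ky) as [r [Hr Hrc]].
    destruct (Hy (r / 2) ltac:(lra)) as [N1 HN1]. destruct (archimed_inv (r / 2) ltac:(lra)) as [N2 HN2].
    specialize (HN1 (N1 + N2)%nat ltac:(lia)).
    pose proof (increasing_ge psi Hpsi (N1 + N2)%nat). specialize (HN2 (psi (N1 + N2)%nat) ltac:(lia)).
    apply (proj2 (Hp (psi (N1 + N2)%nat))).
    revert Hrc. apply relatively_compact_subset. intros q [Kq Hq]. split; [exact Kq|].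
    pose proof (dist_tri y (p (psi (N1 + N2)%nat)) q). rewrite (dist_sym _ y) in HN1. lra. }
  destruct Hunif as [del [Hdel Hunif]]. exists (del / 2). split; [lra|].
  intros u Hu.
  assert (Hv : forall n, exists v, K v /\ d x0 v <= s /\ d v (u n) <= s + del / 2 - s).
  { intros n. destruct (Hu n). apply retract_to_ball; try assumption. lra. }
  destruct (choice _ Hv) as [v Hv'].
  destruct (Hgood v) as [psi [y [Hpsi Hy]]]; [intros n; split; apply Hv'|].
  assert (Ky : K y) by (apply (Kclosed _ _ Hy); intros; apply Hv').
  assert (Hys : d x0 y <= s) by (apply (dist_seq_lim_le _ _ _ _ Hy); intros; apply Hv').
  destruct (Hy (del / 2) ltac:(lra)) as [N HN].
  destruct (Hunif y Ky Hys (fun n => u (psi (N + n)%nat))) as [chi [w [Hchi Hw]]].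
  { intros n. split; [apply Hu|]. specialize (HN (N + n)%nat ltac:(lia)).
    destruct (Hv' (psi (N + n)%nat)) as [_ [_ H1]].
    pose proof (dist_tri y (v (psi (N + n)%nat)) (u (psi (N + n)%nat))).
    rewrite (dist_sym _ y) in HN. lra. }
  exists (fun n => psi (N + chi n)%nat), w. split; [|exact Hw].
  intros n. apply increasing_lt; [exact Hpsi|]. specialize (Hchi n). lia.
Qed.

(** If some radius were bad, the supremum of the good radii would be finite. It would itself be
    good, and so would a larger radius. *)
Lemma hopf_rinow x0 r : K x0 -> relatively_compact (fun y => K y /\ d x0 y <= r).
Proof.
  intros Kx. apply NNPP; intro Hno.
  assert (Hmono : forall a b, a <= b -> good x0 b -> good x0 a).
  { intros a b Hab. apply relatively_compact_subset. intros y [Ky Hy]. split; [exact Ky | lra]. }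
  destruct (Klocal x0 Kx) as [r0 [Hr0 Hgood0]].
  destruct (completeness (good x0)) as [s [Hs1 Hs2]].
  - exists r. intros a Ha. apply Rnot_lt_le; intro Hlt. apply Hno. apply (Hmono r a); [lra | exact Ha].
  - now exists r0.
  - assert (Hs : 0 < s) by (specialize (Hs1 r0 Hgood0); lra).
    assert (Hlt : forall a, a < s -> good x0 a).
    { intros a Ha. apply NNPP; intro Hc. assert (s <= a); [|lra].
      apply Hs2. intros b Hb. apply Rnot_lt_le; intro Hab. apply Hc, (Hmono a b); [lra | exact Hb]. }
    destruct (good_right_open x0 s Kx ltac:(lra) (good_left_closed x0 s Kx Hs Hlt)) as [del [Hdel Hg]].
    specialize (Hs1 _ Hg). lra.
Qed.

End Hopf_Rinow.

(** * Existence of the flow of a single function *)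

Lemma clf_ext D phi D' phi' : (forall y, D y <-> D' y) -> (forall y, D y -> phi y = phi' y) ->
  clf D phi -> clf D' phi'.
Proof.
  intros HD Hphi Hf. split.
  - intros x y t Hx Hy Ht. apply HD in Hx. apply HD in Hy.
    destruct (clf_convex _ _ Hf x y t Hx Hy Ht) as [H1 H2].
    rewrite <- !Hphi by assumption. split; [now apply HD | exact H2].
  - intros u y c Hu Hc. destruct (clf_closed _ _ Hf u y c Hu) as [H1 H2].
    + intros n. destruct (Hc n) as [H1 H2]. apply HD in H1. rewrite Hphi; auto.
    + rewrite <- Hphi by assumption. split; [now apply HD | exact H2].
Qed.

Lemma prox_ext D phi D' phi' lam x y :
  (forall y, D y <-> D' y) -> (forall y, D y -> phi y = phi' y) ->
  prox D phi lam x y -> prox D' phi' lam x y.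
Proof.
  intros HD Hphi [Hy Hmin]. split; [now apply HD|].
  intros z Hz. apply HD in Hz. rewrite <- !Hphi by assumption. auto.
Qed.

(** The splitting result for one factor, with the length of the step as [e]. *)
Lemma resolvent_cv_of_prox D phi (J : R -> H -> H) lam x eps : clf D phi ->
  (forall lam x, 0 < lam -> prox D phi lam x (J lam x)) -> 0 < lam -> 0 < eps ->
  exists del, 0 < del /\ forall rho y, 0 < rho < del ->
    discrete_resolvent (J rho) lam rho x y -> d y (J lam x) < eps.
Proof.
  intros Hf HJ Hl He.
  apply (splitting_resolvent_cv_of_step_bound (fun _ => D) (fun _ => phi) 1 (fun _ _ => Hf) J) with
    (G := fun rho _ => J rho) (e := fun _ rho y => d y (J rho y)); try assumption.
  - intros l y Hl'. apply (prox_ext D phi); [| |now apply HJ].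
    + intros z. split; [auto|]. intros Hz. apply (Hz 0%nat). lia.
    + intros z _. simpl. ring.
  - intros rho j y Hr _. now apply HJ.
  - intros rho j y z Hr _ Hz.
    pose proof (prox_variational D phi rho y _ z Hf Hr (HJ rho y Hr) Hz). lra.
  - intros. lra.
Qed.

Lemma prox_family_nonexpansive D phi (J : R -> H -> H) lam : clf D phi ->
  (forall lam x, 0 < lam -> prox D phi lam x (J lam x)) -> 0 < lam -> nonexpansive (J lam).
Proof.
  intros Hf HJ Hl x y. apply (prox_nonexpansive D phi lam); auto.
Qed.

Lemma gradient_flow_exists D phi (J : R -> H -> H) t x : clf D phi ->
  (forall lam x, 0 < lam -> prox D phi lam x (J lam x)) -> 0 < t -> clos D x ->
  exists s, seq_lim d (fun n => iter n (J (t / INR n)) x) s.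
Proof.
  intros Hf HJ Ht Hx.
  destruct (chernoff D phi Hf J HJ J) with (t := t) (x := x) as [s [Hs _]]; try assumption.
  - intros. now apply (prox_family_nonexpansive D phi).
  - intros. now apply (resolvent_cv_of_prox D phi).
  - now exists s.
Qed.

(** * Gradient flows *)

Section Gradient_flow.
Context (D : H -> Prop) (phi : H -> R) (Hf : clf D phi).
Context (J : R -> H -> H) (HJ : forall lam x, 0 < lam -> prox D phi lam x (J lam x)).
Context (S_ : R -> H -> H).
Context (HS : forall t x, 0 < t -> clos D x -> seq_lim d (fun n => iter n (J (t / INR n)) x) (S_ t x)).

Lemma gradient_flow_nonexpansive t x y : 0 < t -> clos D x -> clos D y ->
  d (S_ t x) (S_ t y) <= d x y.
Proof.
  intros Ht Hx Hy.
  (* The index is shifted because the parameter [t / INR n] must be positive. *)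
  apply (dist_seq_lim2_le (fun n => iter (S n) (J (t / INR (S n))) x)
                          (fun n => iter (S n) (J (t / INR (S n))) y)).
  - apply (seq_lim_subseq (fun n => iter n (J (t / INR n)) x) _ S); [lia | now apply HS].
  - apply (seq_lim_subseq (fun n => iter n (J (t / INR n)) y) _ S); [lia | now apply HS].
  - intros n. apply iter_nonexpansive. apply (prox_family_nonexpansive D phi); auto.
    apply Rdiv_lt_0_compat; [exact Ht | apply lt_0_INR; lia].
Qed.

(** The variational inequalities are summed over the steps. Since [phi] decreases along the
    iterates, its value at the last one replaces all the others. *)
Lemma iterated_prox_variational lam x z n : 0 < lam -> D z ->
  d (iter n (J lam) x) z ^ 2 + 2 * (INR n * lam) * phi (iter n (J lam) x) <=
  d x z ^ 2 + 2 * (INR n * lam) * phi z.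
Proof.
  intros Hl Hz. induction n as [|n IH]; [simpl; lra|].
  rewrite S_INR. cbn [iter]. set (y := iter n (J lam) x) in *.
  pose proof (prox_variational D phi lam y _ z Hf Hl (HJ lam y Hl) Hz) as HV.
  (* For [n = 0] the point [y] is [x], which may lie outside [D]; the factor [INR n] then
     vanishes. *)
  assert (Hmon : INR n * lam * phi (J lam y) <= INR n * lam * phi y).
  { destruct n as [|n]; [simpl; lra|].
    apply Rmult_le_compat_l; [pose proof (pos_INR (S n)); nra|].
    assert (HDy : D y) by (apply (HJ lam _ Hl)).
    pose proof (prox_variational D phi lam y _ y Hf Hl (HJ lam y Hl) HDy) as HV'.
    rewrite dist_xx in HV'. pose proof (pow2_ge_0 (d (J lam y) y)). pose proof (pow2_ge_0 (d y (J lam y))).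
    nra. }
  pose proof (pow2_ge_0 (d y (J lam y))). nra.
Qed.

(** The limit of the preceding inequality with [INR n * lam = t]. It is solved for [phi] so that
    lower semicontinuity yields both membership in [D] and the bound. *)
Lemma gradient_flow_variational t x z : 0 < t -> clos D x -> D z ->
  D (S_ t x) /\ d (S_ t x) z ^ 2 <= d x z ^ 2 - 2 * t * (phi (S_ t x) - phi z).
Proof.
  intros Ht Hx Hz. pose proof (HS t x Ht Hx) as Hlim. set (s := S_ t x) in *.
  destruct (clf_closed_eventually D phi _ s ((d x z ^ 2 + 2 * t * phi z - d s z ^ 2) / (2 * t)) Hf Hlim)
    as [H1 H2].
  - intros eps He.
    destruct (dist_sqr_seq_lim _ s z (2 * t * eps) Hlim) as [N HN]; [nra|].
    exists (S N). intros n Hn. specialize (HN n ltac:(lia)). cbv beta in HN. apply Rabs_def2 in HN.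
    assert (Hn0 : 0 < INR n) by (apply lt_0_INR; lia).
    assert (Hl : 0 < t / INR n) by (apply Rdiv_lt_0_compat; lra).
    pose proof (iterated_prox_variational (t / INR n) x z n Hl Hz) as HV.
    replace (INR n * (t / INR n)) with t in HV by (field; lra).
    split; [destruct n as [|n]; [lia | now apply HJ]|].
    rewrite (dist_sym z s), (dist_sym z (iter n _ x)) in HN.
    replace ((d x z ^ 2 + 2 * t * phi z - d s z ^ 2) / (2 * t) + eps)
      with ((d x z ^ 2 + 2 * t * phi z - d s z ^ 2 + 2 * t * eps) / (2 * t)) by (field; lra).
    apply Rle_div_r; lra.
  - split; [exact H1|]. apply Rle_div_r in H2; lra.
Qed.

Lemma gradient_flow_continuous_at_0 x eps : clos D x -> 0 < eps ->
  exists del, 0 < del /\ forall t, 0 < t < del -> d (S_ t x) x < eps.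
Proof.
  intros Hx He. destruct (Hx (eps / 4) ltac:(lra)) as [z [Hz Hxz]].
  destruct (clf_linear_below D phi z Hf) as [b [Hb Hlow]].
  (* The other terms bound the right side after completing the square in [d z s], while [b * eps]
     ensures [t * b <= eps / 16]. *)
  set (K := Rabs (phi z) + b + b * eps + b ^ 2 + 1).
  pose proof (Rabs_pos (phi z)). pose proof (Rle_abs (phi z)).
  assert (HK : 1 <= K) by (unfold K; nra).
  exists (Rmin 1 (eps ^ 2 / (16 * K))). split.
  { apply Rmin_pos; [lra|]. apply Rdiv_lt_0_compat; nra. }
  intros t [Ht Ht'].
  assert (Ht1 : t < 1) by (eapply Rlt_le_trans; [exact Ht' | apply Rmin_l]).
  assert (Ht2 : t * (16 * K) < eps ^ 2).
  { apply Rlt_div_r; [lra|]. eapply Rlt_le_trans; [exact Ht' | apply Rmin_r]. }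
  destruct (gradient_flow_variational t x z Ht Hx Hz) as [HD HV].
  specialize (Hlow _ HD). set (s := S_ t x) in *.
  rewrite (dist_sym s z) in HV. pose proof (dist_ge0 z s). pose proof (dist_ge0 x z).
  assert (HV' : d z s ^ 2 <= d x z ^ 2 + 2 * t * (phi z + b + b * d z s)).
  { assert (2 * t * (phi z - phi s) <= 2 * t * (phi z + b + b * d z s)) by
      (apply Rmult_le_compat_l; lra). lra. }
  assert (Hsq : (d z s - t * b) ^ 2 <= (eps / 2) ^ 2).
  { assert (d x z ^ 2 <= eps ^ 2 / 16) by nra.
    assert (2 * t * (phi z + b) + t ^ 2 * b ^ 2 <= 2 * t * K).
    { assert (0 <= b * eps) by (apply Rmult_le_pos; lra).
      assert (t ^ 2 * b ^ 2 <= t * b ^ 2) by (pose proof (pow2_ge_0 b); nra).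
      assert (2 * t * (phi z + b) + t * b ^ 2 <= 2 * t * K); [|lra].
      pose proof (pow2_ge_0 b).
      assert (t * (phi z + b) <= t * (Rabs (phi z) + b)) by (apply Rmult_le_compat_l; lra).
      unfold K. nra. }
    nra. }
  assert (Htb : t * b <= eps / 16).
  { assert (t * (b * eps) <= t * K).
    { apply Rmult_le_compat_l; [lra|]. unfold K. pose proof (pow2_ge_0 b). lra. }
    apply Rmult_le_reg_r with eps; [exact He|]. nra. }
  assert (d z s - t * b <= eps / 2) by (apply pow2_le_inv; lra).
  pose proof (dist_tri s z x) as Htri. rewrite (dist_sym s z), (dist_sym z x) in Htri. lra.
Qed.

End Gradient_flow.

(** * Passage from extended-real functions to domains and real values *)

Section Extended_real.
Context (f : H -> Rbar) (Hmin : never_minfty f).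

Lemma Rbar_le_dom y a : Rbar_le (f y) (Finite a) <-> dom f y /\ real (f y) <= a.
Proof.
  unfold dom. specialize (Hmin y). destruct (f y) as [r| |]; simpl; [|split; [tauto|]|tauto].
  - split; [intros Hr; split; [now exists r | exact Hr] | tauto].
  - intros [[r Hr] _]. discriminate.
Qed.

Lemma dom_finite y : dom f y -> f y = Finite (real (f y)).
Proof. intros [r ->]. reflexivity. Qed.

Lemma clf_of_convex_lsc : convex d f -> lsc d f -> clf (dom f) (fun y => real (f y)).
Proof.
  intros Hc Hl. split.
  - intros x y t Hx Hy Ht. apply Rbar_le_dom.
    destruct (geo_spec x y) as [Hg [H0 H1]].
    specialize (Hc _ Hg 0 1 t (real (f x)) (real (f y)) ltac:(lra) ltac:(lra) Ht).
    rewrite H0, H1 in Hc. replace ((1 - t) * 0 + t * 1) with t in Hc by ring.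
    apply Hc; apply Rbar_le_dom; (split; [assumption | lra]).
  - intros u y c Hu HuD. apply Rbar_le_dom. apply (Hl u); [exact Hu|].
    intros n. apply Rbar_le_dom, HuD.
Qed.

Context (Hf : clf (dom f) (fun y => real (f y))) (Hne : exists y, dom f y).

Lemma is_res_min_prox lam x y :
  is_res_min d f lam x y <-> prox (dom f) (fun y => real (f y)) lam x y.
Proof.
  unfold is_res_min, res_obj. split.
  - intros Hy. assert (HD : dom f y).
    { destruct Hne as [z [r Hz]]. specialize (Hy z). rewrite Hz in Hy. specialize (Hmin y).
      destruct (f y) as [s| |] eqn:E; [now exists s | destruct Hy | tauto]. }
    split; [exact HD|]. intros z Hz. specialize (Hy z).
    rewrite (dom_finite y HD), (dom_finite z Hz) in Hy. exact Hy.
  - intros [HD Hy] z. rewrite (dom_finite y HD).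
    destruct (f z) as [r| |] eqn:E; [|exact I|now destruct (Hmin z)].
    specialize (Hy z ltac:(now exists r)). rewrite E in Hy. exact Hy.
Qed.

Lemma resolvent_prox lam x : 0 < lam ->
  prox (dom f) (fun y => real (f y)) lam x (resolvent d f lam x).
Proof.
  intros Hl. unfold resolvent. destruct (Rle_dec lam 0) as [Hle|_]; [lra|].
  apply is_res_min_prox. apply epsilon_spec.
  destruct (prox_exists _ _ lam x Hf Hne Hl) as [y Hy]. exists y. now apply is_res_min_prox.
Qed.

Lemma flow_seq_lim t x : 0 < t -> cl_dom d f x ->
  seq_lim d (fun n => iter n (resolvent d f (t / INR n)) x) (flow d f t x).
Proof.
  intros Ht Hx. unfold flow. apply epsilon_spec.
  exact (gradient_flow_exists _ _ _ t x Hf resolvent_prox Ht Hx).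
Qed.

(* A projection is the resolvent of an indicator function. *)
Lemma proj_prox x : prox (cl_dom d f) (fun _ => 0) (1 / 2) x (proj d (cl_dom d f) x).
Proof.
  unfold proj. set (P := fun y => _ /\ _).
  assert (HP : P (epsilon (inhabits x) P)).
  { apply epsilon_spec.
    destruct (prox_exists _ _ (1 / 2) x (clf_closure _ _ Hf)) as [y [Hy Hmin']].
    - destruct Hne as [y Hy]. exists y. now apply clos_self.
    - lra.
    - exists y. split; [exact Hy|]. intros z Hz. specialize (Hmin' z Hz).
      apply pow2_le_inv; [apply dist_ge0 | lra]. }
  destruct HP as [HC HP]. split; [exact HC|]. intros z Hz. specialize (HP z Hz).
  pose proof (dist_ge0 x (epsilon (inhabits x) P)).
  (* With parameter [1 / 2] the penalty is the squared distance itself. *)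
  replace (2 * (1 / 2)) with 1 by lra. nra.
Qed.

Lemma proj_of_mem x : cl_dom d f x -> proj d (cl_dom d f) x = x.
Proof.
  intros Hx. symmetry. apply dist_eq0. destruct (proj_prox x) as [_ Hp]. specialize (Hp x Hx).
  rewrite dist_xx in Hp. pose proof (dist_ge0 x (proj d (cl_dom d f) x)). nra.
Qed.

Lemma proj_nonexpansive : nonexpansive (proj d (cl_dom d f)).
Proof.
  intros x y. apply (prox_nonexpansive _ _ (1 / 2) _ _ _ _ (clf_closure _ _ Hf) ltac:(lra));
    apply proj_prox.
Qed.

Lemma proj_variational x z : cl_dom d f z ->
  d (proj d (cl_dom d f) x) z ^ 2 <= d x z ^ 2 - d x (proj d (cl_dom d f) x) ^ 2.
Proof.
  intros Hz.
  pose proof (prox_variational _ _ (1 / 2) x _ z (clf_closure _ _ Hf) ltac:(lra) (proj_prox x) Hz).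
  lra.
Qed.

End Extended_real.

Lemma resolvent_0 f t x : t = 0 -> resolvent d f t x = x.
Proof. intros ->. unfold resolvent. destruct (Rle_dec 0 0); [reflexivity | lra]. Qed.

Lemma iter_fixed (F : nat -> H -> H) x : (forall n, F n x = x) -> forall m n, iter m (F n) x = x.
Proof. intros HF m n. induction m as [|m IH]; [reflexivity|]. simpl. now rewrite IH. Qed.

Lemma seq_lim_iter_fixed (F : nat -> H -> H) x : (forall n, F n x = x) ->
  seq_lim d (fun n => iter n (F n) x) x.
Proof.
  intros HF eps He. exists 0%nat. intros n _. now rewrite iter_fixed, dist_xx by exact HF.
Qed.

Lemma flow_0 f t x : t = 0 -> flow d f t x = x.
Proof.
  intros ->. assert (Hx : seq_lim d (fun n => iter n (resolvent d f (0 / INR n)) x) x).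
  { apply (seq_lim_iter_fixed (fun n => resolvent d f (0 / INR n))).
    (* [0 / INR n] is 0 for every [n], also for [n = 0], since the inverse is multiplied by 0. *)
    intros n. apply resolvent_0. unfold Rdiv. ring. }
  apply (seq_lim_unique _ _ _ (epsilon_spec (inhabits x) _ (ex_intro _ x Hx)) Hx).
Qed.

Lemma sumf_value (fs : nat -> H -> Rbar) k y : (forall j, (j < k)%nat -> never_minfty (fs j)) ->
  ((forall j, (j < k)%nat -> dom (fs j) y) /\
     sumf fs k y = Finite (rsum (fun j => real (fs j y)) k)) \/
  (~ (forall j, (j < k)%nat -> dom (fs j) y) /\ sumf fs k y = p_infty).
Proof.
  induction k as [|k IH]; intros Hmin; simpl; [left; split; [intros; lia | reflexivity]|].
  pose proof (Hmin k ltac:(lia) y) as Hk.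
  destruct IH as [[HD ->]|[HD ->]]; [intros; apply Hmin; lia | |].
  - destruct (fs k y) as [r| |] eqn:E; [left|right|tauto].
    + split; [|reflexivity]. intros j Hj. destruct (Nat.eq_dec j k) as [->|]; [now exists r | apply HD; lia].
    + split; [|reflexivity]. intros Hall. destruct (Hall k ltac:(lia)) as [r Hr]. congruence.
  - right. split; [intros Hall; apply HD; intros; apply Hall; lia|].
    destruct (fs k y); [reflexivity | reflexivity | tauto].
Qed.

Lemma comp_res_comp fs k lam x : comp_res d fs k lam x = comp (fun j => resolvent d (fs j) lam) k x.
Proof. induction k as [|k IH]; [reflexivity|]. simpl. now rewrite IH. Qed.

Lemma comp_flow_proj_comp fs k t x : comp_flow_proj d fs k t x =
  comp (fun j y => flow d (fs j) t (proj d (cl_dom d (fs j)) y)) k x.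
Proof. induction k as [|k IH]; [reflexivity|]. simpl. now rewrite IH. Qed.

Lemma iter_ext (F F' : H -> H) n x : (forall y, F y = F' y) -> iter n F x = iter n F' x.
Proof. intros HF. induction n as [|n IH]; [reflexivity|]. simpl. now rewrite IH, HF. Qed.

Lemma comp_fixed (T : nat -> H -> H) k x :
  (forall j, (j < k)%nat -> T j x = x) -> comp T k x = x.
Proof.
  induction k as [|k IH]; intros HT; [reflexivity|]. simpl.
  rewrite IH by (intros; apply HT; lia). apply HT. lia.
Qed.

(** * The product formulas *)

Section Lie_Trotter_Kato.
Context (k : nat) (fs : nat -> H -> Rbar).
Context (Hfs : forall j, (j < k)%nat -> never_minfty (fs j) /\ convex d (fs j) /\ lsc d (fs j)).
Context (Hproper : exists x0, sumf fs k x0 <> p_infty).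

Let D (j : nat) : H -> Prop := dom (fs j).
Let phi (j : nat) (y : H) : R := real (fs j y).

Lemma summand_clf j : (j < k)%nat -> clf (D j) (phi j).
Proof. intros Hj. destruct (Hfs j Hj) as [H1 [H2 H3]]. now apply clf_of_convex_lsc. Qed.

Lemma dom_sumf y : dom (sumf fs k) y <-> forall j, (j < k)%nat -> D j y.
Proof.
  destruct (sumf_value fs k y (fun j Hj => proj1 (Hfs j Hj))) as [[HD E]|[HD E]]; unfold dom at 1;
    rewrite E.
  - split; [intros _; exact HD | intros _; eauto].
  - split; [intros [r Hr]; discriminate | tauto].
Qed.

Lemma real_sumf y : (forall j, (j < k)%nat -> D j y) ->
  rsum (fun j => phi j y) k = real (sumf fs k y).
Proof.
  intros HD. destruct (sumf_value fs k y (fun j Hj => proj1 (Hfs j Hj))) as [[_ E]|[HD' _]];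
    [now rewrite E | tauto].
Qed.

Lemma sumf_never_minfty : never_minfty (sumf fs k).
Proof.
  intros y. destruct (sumf_value fs k y (fun j Hj => proj1 (Hfs j Hj))) as [[_ ->]|[_ ->]]; discriminate.
Qed.

Lemma sumf_dom_nonempty : exists y, dom (sumf fs k) y.
Proof.
  destruct Hproper as [x0 Hx0]. exists x0. apply dom_sumf.
  destruct (sumf_value fs k x0 (fun j Hj => proj1 (Hfs j Hj))) as [[HD _]|[_ E]]; tauto.
Qed.

Lemma sumf_clf : clf (dom (sumf fs k)) (fun y => real (sumf fs k y)).
Proof.
  eapply clf_ext; [| |apply (clf_sum D phi k summand_clf)].
  - intros y. symmetry. apply dom_sumf.
  - intros y HD. now apply real_sumf.
Qed.

Lemma summand_dom_nonempty j : (j < k)%nat -> exists y, dom (fs j) y.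
Proof.
  intros Hj. destruct sumf_dom_nonempty as [y Hy]. exists y. now apply dom_sumf.
Qed.

Lemma cl_dom_summand j x : (j < k)%nat -> cl_dom d (sumf fs k) x -> cl_dom d (fs j) x.
Proof.
  intros Hj Hx eps He. destruct (Hx eps He) as [y [Hy Hy']]. exists y. split; [|exact Hy'].
  now apply (proj1 (dom_sumf y) Hy).
Qed.

Lemma sumf_resolvent_prox lam x : 0 < lam ->
  prox (dom (sumf fs k)) (fun y => real (sumf fs k y)) lam x (resolvent d (sumf fs k) lam x).
Proof.
  apply resolvent_prox; [apply sumf_never_minfty | apply sumf_clf | apply sumf_dom_nonempty].
Qed.

Lemma sum_resolvent_prox lam x : 0 < lam ->
  prox (fun y => forall j, (j < k)%nat -> D j y) (fun y => rsum (fun j => phi j y) k) lam x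
    (resolvent d (sumf fs k) lam x).
Proof.
  intros Hl. eapply prox_ext; [| |now apply sumf_resolvent_prox].
  - apply dom_sumf.
  - intros y Hy. symmetry. apply real_sumf, dom_sumf, Hy.
Qed.

Lemma summand_resolvent_prox j lam x : (j < k)%nat -> 0 < lam ->
  prox (D j) (phi j) lam x (resolvent d (fs j) lam x).
Proof.
  intros Hj. apply resolvent_prox; [apply Hfs, Hj | now apply summand_clf | now apply summand_dom_nonempty].
Qed.

(** For positive [t], Chernoff's formula gives the products of [F] and the iterated resolvents a
    common limit, which uniqueness identifies with the flow. At [t = 0] both sides are constant. *)
Lemma product_formula (F : R -> H -> H) :
  (forall rho, 0 < rho -> nonexpansive (F rho)) ->
  (forall lam x eps, 0 < lam -> 0 < eps -> exists del, 0 < del /\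
     forall rho y, 0 < rho < del -> discrete_resolvent (F rho) lam rho x y ->
       d y (resolvent d (sumf fs k) lam x) < eps) ->
  (forall t x, t = 0 -> cl_dom d (sumf fs k) x -> F t x = x) ->
  forall t x, 0 <= t -> cl_dom d (sumf fs k) x ->
    seq_lim d (fun n => iter n (F (t / INR n)) x) (flow d (sumf fs k) t x).
Proof.
  intros HF HR H0 t x Ht Hx. destruct (Req_dec t 0) as [->|Hne].
  - rewrite flow_0 by reflexivity. apply (seq_lim_iter_fixed (fun n => F (0 / INR n))).
    intros n. apply H0; [unfold Rdiv; ring | exact Hx].
  - destruct (chernoff _ _ sumf_clf (resolvent d (sumf fs k)) sumf_resolvent_prox F HF HR t x
      ltac:(lra) Hx) as [s [Hs1 Hs2]].
    replace (flow d (sumf fs k) t x) with s; [exact Hs1|].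
    apply (seq_lim_unique _ _ _ Hs2). apply flow_seq_lim; try assumption; try lra.
    + apply sumf_never_minfty.
    + apply sumf_clf.
    + apply sumf_dom_nonempty.
Qed.

Lemma resolvent_product_formula t x : 0 <= t -> cl_dom d (sumf fs k) x ->
  seq_lim d (fun n => iter n (comp_res d fs k (t / INR n)) x) (flow d (sumf fs k) t x).
Proof.
  assert (Hn : forall rho j, 0 < rho -> (j < k)%nat -> nonexpansive (resolvent d (fs j) rho)).
  { intros rho j Hr Hj. apply (prox_family_nonexpansive (D j) (phi j)); auto using summand_clf.
    intros. now apply summand_resolvent_prox. }
  intros Ht Hx.
  assert (Hlim := product_formula (fun rho => comp (fun j => resolvent d (fs j) rho) k)).
  (* The two sequences agree term by term; [seq_lim_near] replaces a rewrite under the binder. *)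
  eapply seq_lim_near; [|apply Hlim; try assumption].
  - intros eps He. exists 0%nat. intros n _. cbv beta.
    erewrite iter_ext; [rewrite dist_xx; exact He|]. intros y. symmetry. apply comp_res_comp.
  - intros rho Hr. apply comp_nonexpansive. intros j Hj. now apply Hn.
  - intros lam y eps Hl He.
    apply (splitting_resolvent_cv_of_step_bound D phi k summand_clf _ sum_resolvent_prox
      (fun rho j => resolvent d (fs j) rho) (fun j rho y => d y (resolvent d (fs j) rho y))); try assumption.
    + intros rho j w Hr Hj. now apply summand_resolvent_prox.
    + intros rho j w z Hr Hj Hz.
      pose proof (prox_variational _ _ rho w _ z (summand_clf j Hj) Hr
        (summand_resolvent_prox j rho w Hj Hr) Hz). lra.
    + intros. lra.
  - intros s y Hs Hy. apply comp_fixed. intros j Hj. now apply resolvent_0.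
Qed.

(** Hopf-Rinow is applied to the sublevel set, which is closed even when the domain is not. It
    inherits relatively compact balls from the domain, and the sequence stays within [2 * B] of its
    first term. *)
Lemma sublevel_relatively_compact l c B z (u : nat -> H) : (l < k)%nat ->
  locally_compact d (dom (fs l)) ->
  (forall n, D l (u n) /\ phi l (u n) <= c /\ d z (u n) <= B) ->
  exists psi y, (forall n, (psi n < psi (S n))%nat) /\ seq_lim d (fun n => u (psi n)) y.
Proof.
  intros Hl Hloc Hu. pose proof (summand_clf l Hl) as Hf.
  apply (hopf_rinow (fun y => D l y /\ phi l y <= c)) with (x0 := u 0%nat) (r := 2 * B).
  - intros v y Hv Hc. exact (clf_closed _ _ Hf v y c Hv Hc).
  - intros y y' t [Hy1 Hy2] [Hy1' Hy2'] Ht.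
    destruct (clf_convex _ _ Hf y y' t Hy1 Hy1' Ht). split; [assumption | nra].
  - intros y [Hy _]. destruct (Hloc y Hy) as [r [Hr Hcpt]]. exists r. split; [exact Hr|].
    intros v Hv. destruct (Hcpt v) as [psi [w [Hpsi [_ Hw]]]]; [|now exists psi, w].
    intros n. destruct (Hv n) as [[H1 _] H2]. now split.
  - destruct (Hu 0%nat) as [H1 [H2 _]]. now split.
  - intros n. destruct (Hu n) as [H1 [H2 H3]]. destruct (Hu 0%nat) as [_ [_ H3']].
    repeat split; try assumption.
    pose proof (dist_tri (u 0%nat) z (u n)). rewrite (dist_sym (u 0%nat) z) in *. lra.
Qed.

Lemma flow_product_formula l t x : (l < k)%nat -> locally_compact d (dom (fs l)) ->
  0 <= t -> cl_dom d (sumf fs k) x ->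
  seq_lim d (fun n => iter n (comp_flow_proj d fs k (t / INR n)) x) (flow d (sumf fs k) t x).
Proof.
  intros Hl Hloc Ht Hx.
  set (P := fun j => proj d (cl_dom d (fs j))).
  set (G := fun rho j y => flow d (fs j) rho (P j y)).
  assert (HP : forall j y, (j < k)%nat -> clos (D j) (P j y)).
  { intros j y Hj. apply (proj_prox (fs j) (summand_clf j Hj) (summand_dom_nonempty j Hj) y). }
  assert (HS : forall j, (j < k)%nat -> forall t x, 0 < t -> clos (D j) x ->
    seq_lim d (fun n => iter n (resolvent d (fs j) (t / INR n)) x) (flow d (fs j) t x)).
  { intros j Hj t' y Ht' Hy. apply flow_seq_lim; try assumption;
      [apply Hfs, Hj | now apply summand_clf | now apply summand_dom_nonempty]. }
  assert (HJ : forall j, (j < k)%nat -> forall lam x, 0 < lam ->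
    prox (D j) (phi j) lam x (resolvent d (fs j) lam x)).
  { intros. now apply summand_resolvent_prox. }
  (* The variational inequality of the flow started at [P j y] is combined with that of the
     projection, whose squared displacement becomes the error term. *)
  assert (HV : forall rho j y z, 0 < rho -> (j < k)%nat -> D j z ->
    D j (G rho j y) /\
    d (G rho j y) z ^ 2 <= d y z ^ 2 - 2 * rho * (phi j (G rho j y) - phi j z) - d y (P j y) ^ 2).
  { intros rho j y z Hr Hj Hz.
    destruct (gradient_flow_variational (D j) (phi j) (summand_clf j Hj) _ (HJ j Hj) _ (HS j Hj)
      rho (P j y) z Hr (HP j y Hj) Hz) as [H1 H2]. split; [exact H1|].
    pose proof (proj_variational (fs j) (summand_clf j Hj) (summand_dom_nonempty j Hj) y z
      (clos_self _ _ Hz)) as H3. fold (P j) in H3. unfold G. lra. }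
  assert (Hn : forall rho j, 0 < rho -> (j < k)%nat -> nonexpansive (G rho j)).
  { intros rho j Hr Hj y y'. unfold G.
    eapply Rle_trans.
    - apply (gradient_flow_nonexpansive (D j) (phi j) (summand_clf j Hj) _ (HJ j Hj) _ (HS j Hj)); auto.
    - apply proj_nonexpansive; [now apply summand_clf | now apply summand_dom_nonempty]. }
  assert (Hlim := product_formula (fun rho => comp (G rho) k)).
  eapply seq_lim_near; [|apply Hlim; try assumption].
  - intros eps He. exists 0%nat. intros n _. cbv beta.
    erewrite iter_ext; [rewrite dist_xx; exact He|]. intros y. symmetry. apply comp_flow_proj_comp.
  - intros rho Hr. apply comp_nonexpansive. intros j Hj. now apply Hn.
  - intros lam y eps Hlam He.
    apply (splitting_resolvent_cv_of_compact D phi k summand_clf _ sum_resolvent_prox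
      G (fun j rho y => d y (P j y))) with (P := P) (l := l); try assumption.
    + intros rho j w Hr Hj. destruct (summand_dom_nonempty j Hj) as [z Hz]. now apply (HV rho j w z).
    + intros rho j w z Hr Hj Hz. now apply HV.
    + intros. lra.
    + intros j u eta Hj Hu Heta. unfold G, P. rewrite proj_of_mem;
        [|now apply summand_clf | now apply summand_dom_nonempty | exact Hu].
      apply (gradient_flow_continuous_at_0 (D j) (phi j) (summand_clf j Hj) _ (HJ j Hj) _ (HS j Hj));
        assumption.
    + intros c B z u Hu. now apply (sublevel_relatively_compact l c B z).
  - intros s y Hs Hy. apply comp_fixed. intros j Hj. unfold G, P.
    rewrite flow_0 by exact Hs.
    apply proj_of_mem; [now apply summand_clf | now apply summand_dom_nonempty | now apply cl_dom_summand].
Qed.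

End Lie_Trotter_Kato.

End Hadamard_space.

Theorem theorem1p4 (H : Type) (d : H -> H -> R) (k : nat)
  (fs : nat -> H -> Rbar) :
  hadamard d ->
  (forall j, (j < k)%nat ->
     never_minfty (fs j) /\ convex d (fs j) /\ lsc d (fs j)) ->
  (exists x0, sumf fs k x0 <> p_infty) ->
  (forall t x, 0 <= t -> cl_dom d (sumf fs k) x ->
     seq_lim d (fun n => iter n (comp_res d fs k (t / INR n)) x)
               (flow d (sumf fs k) t x))
  /\
  ((exists l, (l < k)%nat /\ locally_compact d (dom (fs l))) ->
   forall t x, 0 <= t -> cl_dom d (sumf fs k) x ->
     seq_lim d (fun n => iter n (comp_flow_proj d fs k (t / INR n)) x)
               (flow d (sumf fs k) t x)).
Proof.
  intros Hd Hfs Hproper. split.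
  - intros t x. now apply resolvent_product_formula.
  - intros [l [Hl Hloc]] t x. now apply (flow_product_formula Hd k fs Hfs Hproper l).
Qed.
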